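(* Let $\mathcal{C}$ be the class of finite Horn default theories $\langle D,W\rangle$, where $W$ is a finite set of literals and the defaults in $D$ are of the form $p_1\wedge\cdots\wedge p_n{:}l/l$ where $l$ is a literal and $p_1,\ldots,p_n$ are propositional variables. For $\Delta=\langle D,W\rangle\in\mathcal{C}$, negated Horn clauses $\phi$, and strict total orders $\mathcal{P}$ on $D$, the problem of testing $\Delta\models^L_{\mathcal{P}}\neg\phi$ is solvable in polynomial time in the size of $D\cup W\cup\{\neg\phi\}$.
   Context: $\mathcal{L}$ is the set of formulae of classical propositional logic, $\models$ classical logical consequence, and $Cn(S)=\{\phi\in\mathcal{L}\mid S\models\phi\}$ for $S\subseteq\mathcal{L}$. A default is a rule $\alpha{:}\beta_1,\ldots,\beta_n/\gamma$ with $\alpha,\beta_1,\ldots,\beta_n,\gamma\in\mathcal{L}$ (prerequisite $\alpha$, justifications $\beta_j$, conclusion $\gamma$). A default theory is a pair $\langle D,W\rangle$ with $D$ a set of defaults and $W\subseteq\mathcal{L}$. In Horn defaults the prerequisite conjunction may be empty ($\top$). (Reiter) extensions: for $S\subseteq\mathcal{L}$ let $\Gamma(S)$ be the smallest set such that $W\subseteq\Gamma(S)$, $Cn(\Gamma(S))=\Gamma(S)$, and whenever $\alpha{:}\beta_1,\ldots,\beta_n/\gamma\in D$, $\alpha\in\Gamma(S)$ and $\{\neg\beta_1,\ldots,\neg\beta_n\}\cap S=\emptyset$, then $\gamma\in\Gamma(S)$. $E\subseteq\mathcal{L}$ is an extension of $\langle D,W\rangle$ iff $\Gamma(E)=E$.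 A default $\alpha{:}\beta_1,\ldots,\beta_n/\gamma$ is applied in $E$, written $\mathrm{appl}(\delta,E)$ for this default $\delta$, if $E\models\alpha$ and $\{\neg\beta_1,\ldots,\neg\beta_n\}\cap Cn(E)=\emptyset$. $\mathrm{appl}(\delta,E,E')$ abbreviates ''$\mathrm{appl}(\delta,E)$ and not $\mathrm{appl}(\delta,E')$''. Let $\mathcal{P}$ be a strict partial order (transitive, asymmetric) on $D$; $\delta\mathcal{P}\delta'$ means $\delta$ has higher priority. An extension $E$ of $\Delta=\langle D,W\rangle$ is a $\mathcal{P}$-preferred$^L$ extension of $\Delta$ if there is a strict total order $\mathcal{T}$ on $D$ such that $\mathcal{P}\subseteq\mathcal{T}$ and for all extensions $E'$ of $\Delta$ and all $\delta\in D$: $\mathrm{appl}(\delta,E',E)$ implies that for some $\epsilon\in D$, $\epsilon\mathcal{T}\delta$ and $\mathrm{appl}(\epsilon,E,E')$. $\Delta\models^L_{\mathcal{P}}\psi$ means that $\psi$ belongs to all $\mathcal{P}$-preferred$^L$ extensions of $\Delta$. *)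

(* Defs.v *)
From HB Require Import structures.
From Corelib Require Import BinNums.
From mathcomp Require Import all_boot all_order all_algebra.
From mathcomp Require Import boolp classical_sets.

Set Implicit Arguments.
Unset Strict Implicit.
Unset Printing Implicit Defensive.

Local Open Scope classical_set_scope.

Inductive formula : Type :=
| Var of nat
| Top
| Bot
| Not of formula
| And of formula & formula
| Or of formula & formula
| Imp of formula & formula.

HB.instance Definition _ := gen_eqMixin formula.

Fixpoint eval (v : nat -> bool) (f : formula) : bool :=
  match f with
  | Var n => v n
  | Top => true
  | Bot => false
  | Not g => ~~ eval v g
  | And g h => eval v g && eval v h
  | Or g h => eval v g || eval v h
  | Imp g h => eval v g ==> eval v h
  end.

Definition entails (S : set formula) (f : formula) : Prop :=
  forall v : nat -> bool, (forall g, S g -> eval v g) -> eval v f.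

Definition Cn (S : set formula) : set formula := [set f | entails S f].

Record default : Type := Default {
  prereq : formula;
  justs : seq formula;
  concl : formula
}.

Definition neg_justs (d : default) : set formula :=
  [set` map Not (justs d)].

Definition closed_under (D : set default) (S G : set formula) : Prop :=
  forall d, D d -> G (prereq d) -> neg_justs d `&` S = set0 -> G (concl d).

(* [smallest C W] is the intersection of all the sets that satisfy C and
   contain W; it satisfies C itself here, as both conditions below are
   preserved by intersections. *)
Definition Gamma (D : set default) (W S : set formula) : set formula :=
  smallest [set G | Cn G = G /\ closed_under D S G] W.

Definition extension (D : set default) (W E : set formula) : Prop :=
  Gamma D W E = E.

Definition appl (d : default) (E : set formula) : Prop :=
  entails E (prereq d) /\ neg_justs d `&` Cn E = set0.

Definition appl_not (d : default) (E E' : set formula) : Prop :=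
  appl d E /\ ~ appl d E'.

(* An order on D is a relation on all defaults of which only the restriction
   to D matters. *)
Definition strict_order (D : set default) (P : default -> default -> Prop) :
    Prop :=
  (forall d e f, D d -> D e -> D f -> P d e -> P e f -> P d f) /\
  (forall d e, D d -> D e -> P d e -> ~ P e d).

Definition strict_total_order (D : set default)
    (P : default -> default -> Prop) : Prop :=
  strict_order D P /\ (forall d e, D d -> D e -> d <> e -> P d e \/ P e d).

(* [P d e] means that d has higher priority than e. *)
Definition preferredL (D : set default) (W : set formula)
    (P : default -> default -> Prop) (E : set formula) : Prop :=
  extension D W E /\
  exists T : default -> default -> Prop,
    [/\ strict_total_order D T,
        (forall d e, D d -> D e -> P d e -> T d e) &
        forall E' d, extension D W E' -> D d -> appl_not d E' E ->
          exists e, [/\ D e, T e d & appl_not e E E']].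

Definition entailsL (D : set default) (W : set formula)
    (P : default -> default -> Prop) (f : formula) : Prop :=
  forall E, preferredL D W P E -> E f.

(* A literal is a sign (true for a positive literal) and a variable. *)
Definition literal : Type := (bool * nat)%type.

Definition lit_formula (l : literal) : formula :=
  if l.1 then Var l.2 else Not (Var l.2).

(* The pair (ps, l) stands for the default p1 /\ .. /\ pn : l / l. *)
Definition horn_default : Type := (seq nat * literal)%type.

Definition horn_rule (h : horn_default) : default :=
  Default (foldr And Top (map Var h.1)) [:: lit_formula h.2]
    (lit_formula h.2).

Definition horn_D (hs : seq horn_default) : set default :=
  horn_rule @` [set` hs].

Definition literals_W (ws : seq literal) : set formula :=
  lit_formula @` [set` ws].

Definition is_horn (c : seq literal) : bool :=
  count (fun l : literal => l.1) c <= 1.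

Definition clause (c : seq literal) : formula :=
  foldr Or Bot (map lit_formula c).

(* [hs] lists its defaults by decreasing priority; for a strict order P this
   excludes repetitions, and a finite D with a strict total order P has exactly
   one such listing. *)
Definition lists_by_priority (P : default -> default -> Prop)
    (hs : seq horn_default) : Prop :=
  pairwise (fun h h' => `[< P (horn_rule h) (horn_rule h') >]) hs.

Inductive symbol : Type := Zero | One | Plus | Minus | Colon | Semi | Hash.

Definition ord_of_symbol (s : symbol) : 'I_7 :=
  match s with
  | Zero => inord 0 | One => inord 1 | Plus => inord 2 | Minus => inord 3
  | Colon => inord 4 | Semi => inord 5 | Hash => inord 6
  end.

Definition symbol_of_ord (i : 'I_7) : symbol :=
  nth Zero [:: Zero; One; Plus; Minus; Colon; Semi; Hash] i.

Lemma ord_of_symbolK : cancel ord_of_symbol symbol_of_ord.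
Proof. by case; rewrite /symbol_of_ord /= inordK. Qed.

HB.instance Definition _ := Finite.copy symbol (can_type ord_of_symbolK).

(* Variables are written in binary, least significant bit first, so that the
   size of an input is not inflated by large variable indices. *)
Fixpoint encode_positive (p : positive) : seq symbol :=
  match p with
  | xH => [:: One]
  | xO q => Zero :: encode_positive q
  | xI q => One :: encode_positive q
  end.

Definition encode_nat (n : nat) : seq symbol :=
  if bin_of_nat n is Npos p then encode_positive p else [::].

Definition encode_literal (l : literal) : seq symbol :=
  (if l.1 then Plus else Minus) :: encode_nat l.2.

Definition encode_default (h : horn_default) : seq symbol :=
  flatten [seq encode_literal (true, p) | p <- h.1]
    ++ Colon :: rcons (encode_literal h.2) Semi.

(* The input word: D in the order of decreasing priority, then W, then the
   clause. *)
Definition encode (hs : seq horn_default) (ws c : seq literal) : seq symbol :=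
  flatten (map encode_default hs)
    ++ Hash :: flatten (map encode_literal ws)
    ++ Hash :: flatten (map encode_literal c).

Inductive move : Type := MoveL | Stay | MoveR.

(* Deterministic Turing machines with ntapes.+1 two-way infinite tapes. A tape
   symbol is the blank (None), an input symbol or a work symbol. [final] tells
   whether a state is running (None), accepting or rejecting. *)
Record tm (S : finType) : Type := TM {
  ntapes : nat;
  work : finType;
  state : finType;
  start : state;
  final : state -> option bool;
  trans : state -> {ffun 'I_ntapes.+1 -> option (S + work)} ->
          state * {ffun 'I_ntapes.+1 -> option (S + work) * move}
}.

(* The cells to the left of the head, nearest first, and the cells from the
   head on; the cells that are not listed are blank. *)
Record tape (A : Type) : Type := Tape {
  tleft : seq (option A);
  tright : seq (option A)
}.

Definition scanned (A : Type) (t : tape A) : option A := head None (tright t).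

Definition tape_act (A : Type) (t : tape A) (am : option A * move) : tape A :=
  let: (a, m) := am in
  let: Tape l r := t in
  match m with
  | MoveL => Tape (behead l) (head None l :: a :: behead r)
  | Stay => Tape l (a :: behead r)
  | MoveR => Tape (a :: l) (behead r)
  end.

Definition config (S : finType) (M : tm S) : Type :=
  (state M * {ffun 'I_(ntapes M).+1 -> tape (S + work M)})%type.

Definition init (S : finType) (M : tm S) (w : seq S) : config M :=
  (start M,
   [ffun i => if i == ord0 then Tape [::] [seq Some (inl s) | s <- w]
              else Tape [::] [::]]).

Definition step (S : finType) (M : tm S) (x : config M) : config M :=
  let: (q, ts) := x in
  if final q is Some _ then x else
  let: (q', acts) := trans q [ffun i => scanned (ts i)] in
  (q', [ffun i => tape_act (ts i) (acts i)]).

(* On input w, M halts after at most n steps and accepts iff Q holds. *)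
Definition decides_within (S : finType) (M : tm S) (n : nat) (w : seq S)
    (Q : Prop) : Prop :=
  exists t b,
    [/\ t <= n, final (iter t (@step S M) (init M w)).1 = Some b & b <-> Q].

(* Main.v *)
(* As P is total, the only admissible T is P itself, and there is exactly one
   preferred extension: the lexicographically best one, obtained by going
   through the defaults by decreasing priority and keeping a default whenever
   some extension applies it together with all those kept so far.  Premises are
   positive, so this last question is easy: forward chain from W with the
   defaults whose conclusion is positive and not the complement of a fact or of
   the conclusion of a kept default; an extension that applies the kept defaults
   exists iff their conclusions are consistent with W and each other and their
   premises have been reached.  If the resulting set of literals L is consistent,
   a clause follows from it iff the clause contains a literal of L or a
   complementary pair.

   For the machine, data are binary trees written in prefix order on a stack; a
   program for f replaces the tree on top of the main stack by its image and
   leaves everything below untouched, which makes programs composable.  The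
   polynomial-time functions in this sense are closed under composition,
   pairing, case analysis and folds whose steps enlarge the accumulator by a
   bounded amount, and the whole procedure is assembled from these. *)
From HB Require Import structures.
Require Import Defs.
From mathcomp Require Import all_boot all_order all_algebra.
From mathcomp Require Import boolp classical_sets.
From mathcomp Require Import zify.

Set Implicit Arguments.
Unset Strict Implicit.
Unset Printing Implicit Defensive.

(** * Machine fragments and stacks *)

Section Fragments.

Variables (n : nat) (A : Type).

Let reading := {ffun 'I_n -> option A}.
Let action := {ffun 'I_n -> option A * move}.
Let tapes := {ffun 'I_n -> tape A}.

(* A piece of machine with one entry and one exit: the next state [None] means
   that control leaves the fragment. *)
Record fragment := Fragment {
  fstate : finType;
  fstart : fstate;
  fnext : fstate -> reading -> option fstate * action
}.

Definition reads (ts : tapes) : reading := [ffun i => scanned (ts i)].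

Definition act (ts : tapes) (a : action) : tapes :=
  [ffun i => tape_act (ts i) (a i)].

Definition keep (r : reading) : action := [ffun i => (r i, Stay)].

(** The number [t] is only an upper bound on the steps before the exit, so that time bounds can be
    weakened freely. *)
Fixpoint exits (F : fragment) (t : nat) (q : fstate F) (ts ts' : tapes) : Prop :=
  if t is t1.+1 then
    let: (q', a) := fnext q (reads ts) in
    if q' is Some q1 then exits t1 q1 (act ts a) ts' else act ts a = ts'
  else False.

Lemma exits_leq F t t' (q : fstate F) ts ts' :
  t <= t' -> exits t q ts ts' -> exits t' q ts ts'.
Proof.
elim: t t' q ts => [|t IH] [|t'] q ts //= le_tt'.
by case: (fnext q _) => [[q1|] a] //; apply: IH.
Qed.

(* A tape holds a stack when the head scans its top and the rest of the stack
   lies to the right; the cells to the left are garbage. *)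
Definition holds (t : tape A) (s : seq A) : Prop :=
  forall i, nth None (tright t) i = onth s i.

Let stacks := 'I_n -> seq A.

Definition hold (ts : tapes) (s : stacks) : Prop := forall i, holds (ts i) (s i).

(** Quantifying over all tapes that hold the stacks makes fragments insensitive to the garbage on
    the left and to how blanks are listed. *)
Definition computes (F : fragment) (s s' : stacks) (t : nat) : Prop :=
  forall ts, hold ts s -> exists2 ts', exits t (fstart F) ts ts' & hold ts' s'.

Lemma computes_leq F s s' t t' :
  t <= t' -> computes F s s' t -> computes F s s' t'.
Proof.
move=> le_tt' Fs ts /Fs[ts' ex_t ?]; exists ts' => //; exact: exits_leq ex_t.
Qed.

Lemma hold_scanned ts s i : hold ts s -> scanned (ts i) = ohead (s i).
Proof. by move=> /(_ i 0); rewrite /scanned nth0 => ->; case: (s i). Qed.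

(** Writing back a scanned blank may list a cell that was not listed before: the tape changes, the
    stack it holds does not. *)
Lemma holds_keep t s : holds t s -> holds (tape_act t (scanned t, Stay)) s.
Proof. by case: t => l [|x r] // ts i; rewrite -ts; case: i => //= i; rewrite nth_nil.
    Qed.

Lemma hold_keep ts s : hold ts s -> hold (act ts (keep (reads ts))) s.
Proof. by move=> ts_s i; rewrite !ffunE; apply: holds_keep. Qed.

(** The step that leaves [F] enters [G] directly, so that running times simply add up. *)
Definition fseq (F G : fragment) : fragment :=
  @Fragment (fstate F + fstate G)%type (inl (fstart F)) (fun q r =>
    match q with
    | inl q => let: (q', a) := fnext q r in
               (Some (if q' is Some q1 then inl q1 else inr (fstart G)), a)
    | inr q => let: (q', a) := fnext q r in (omap inr q', a)
    end).

Lemma fseq_computes F G s1 s2 s3 t u :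
  computes F s1 s2 t -> computes G s2 s3 u ->
  computes (fseq F G) s1 s3 (t + u).
Proof.
move=> Fs Gs ts /Fs[ts2 exF /Gs[ts3 exG ?]] {Fs Gs}; exists ts3 => //=.
have {}exG : exits u (inr (fstart G) : fstate (fseq F G)) ts2 ts3.
  elim: u (fstart G) ts2 exG {exF} => [|u IH] q ts2 //=.
  by case: (fnext q _) => [[q1|] a] //=; apply: IH.
elim: t (fstart F) ts exF => [|t IH] q ts0 //=.
case: (fnext q _) => [[q1|] a] /=; first exact: IH.
by move=> ->; apply: exits_leq exG; rewrite leq_addl.
Qed.

Definition fif (b : reading -> bool) (F G : fragment) : fragment :=
  @Fragment (option (fstate F + fstate G)) None (fun q r =>
    match q with
    | None => (Some (Some (if b r then inl (fstart F) else inr (fstart G))), keep r)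
    | Some (inl q) => let: (q', a) := fnext q r in (omap (Some \o inl) q', a)
    | Some (inr q) => let: (q', a) := fnext q r in (omap (Some \o inr) q', a)
    end).

Definition tops (s : stacks) : reading := [ffun i => ohead (s i)].

Lemma hold_reads ts s : hold ts s -> reads ts = tops s.
Proof. by move=> ts_s; apply/ffunP=> i; rewrite !ffunE (hold_scanned _ ts_s). Qed.

Lemma fif_computes b F G s s' t :
  computes (if b (tops s) then F else G) s s' t ->
  computes (fif b F G) s s' t.+1.
Proof.
move=> FG ts ts_s; have [ts' exFG ?] := FG _ (hold_keep ts_s).
exists ts' => //=; rewrite -(hold_reads ts_s) in exFG.
case: (b _) exFG.
  elim: t (fstart F) (act _ _) {FG} => [|t IH] q ts1 //=.
  by case: (fnext q _) => [[q1|] a] //=; apply: IH.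
elim: t (fstart G) (act _ _) {FG} => [|t IH] q ts1 //=.
by case: (fnext q _) => [[q1|] a] //=; apply: IH.
Qed.

(** The state [None] is the test; an exit [None] of the body becomes [Some None], which leads back
    to it. *)
Definition fwhile (b : reading -> bool) (F : fragment) : fragment :=
  @Fragment (option (fstate F)) None (fun q r =>
    if q is Some q then let: (q', a) := fnext q r in (Some q', a)
    else ((if b r then Some (Some (fstart F)) else None), keep r)).

Lemma fwhile_computes_stop (b : reading -> bool) F s : b (tops s) = false -> computes
    (fwhile b F) s s 1.
Proof.
move=> bF ts ts_s; exists (act ts (keep (reads ts))); last exact: hold_keep.
by rewrite /= (hold_reads ts_s) bF.
Qed.

Lemma fwhile_computes_loop (b : reading -> bool) F s s1 s' t u :
  b (tops s) -> computes F s s1 t -> computes (fwhile b F) s1 s' u ->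
  computes (fwhile b F) s s' (t + u).+1.
Proof.
move=> bT Fs Ws ts ts_s; have [ts1 exF /Ws[ts2 exW ?]] := Fs _ (hold_keep ts_s).
exists ts2 => //=; rewrite (hold_reads ts_s) bT -(hold_reads ts_s).
elim: t (fstart F) (act _ _) exF {Fs} => [|t IH] q ts0 //=.
case: (fnext q _) => [[q1|] a] /=; first exact: IH.
by move=> ->; apply: exits_leq exW; rewrite leq_addl.
Qed.

Definition fskip : fragment := @Fragment unit tt (fun _ r => (None, keep r)).

Lemma fskip_computes s : computes fskip s s 1.
Proof. by move=> ts ts_s; exists (act ts (keep (reads ts))) => //; apply: hold_keep.
    Qed.

Definition update (s : stacks) (j : 'I_n) (x : seq A) : stacks :=
  fun i => if i == j then x else s i.

Definition fpop (j : 'I_n) : fragment :=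
  @Fragment unit tt (fun _ r =>
    (None, [ffun i => (r i, if i == j then MoveR else Stay)])).

Lemma fpop_computes j s : computes (fpop j) s (update s j (behead (s j))) 1.
Proof.
move=> ts ts_s; exists (act ts [ffun i =>
    (reads ts i, if i == j then MoveR else Stay)]) => // i.
rewrite !ffunE /update; case: eqP => [->|_]; last exact: holds_keep.
move=> k; have := ts_s j k.+1; case: (ts j) => l r /=.
by rewrite nth_behead => ->; case: (s j); case: k.
Qed.

(* The head first moves to the garbage cell on the left, then writes there. *)
Definition fpush (j : 'I_n) (a : A) : fragment :=
  @Fragment bool false (fun q r =>
    if q then (None, [ffun i => (if i == j then Some a else r i, Stay)])
    else (Some true, [ffun i => (r i, if i == j then MoveL else Stay)])).

Lemma fpush_computes j a s : computes (fpush j a) s (update s j (a :: s j)) 2.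
Proof.
move=> ts ts_s; eexists; first reflexivity.
move=> i; rewrite !ffunE /update; case: eqP => [->|_]; last first.
  by apply/holds_keep/holds_keep.
move: (ts_s j); case: (ts j) => l r s_j [|k] //=; rewrite -s_j.
by case: r {s_j} k => [|x r] [|k] //=; rewrite nth_nil.
Qed.

End Fragments.

Arguments fskip {n A}.
Arguments fpop {n A} j.

(** * Trees on the main stack *)

Inductive tree : Type := Leaf | Node of tree & tree.

(** Prefix order is self-delimiting: the end of the topmost tree is found without a marker, by
    counting the subtrees still to be read. *)
Fixpoint prefix_code (x : tree) : seq bool :=
  if x is Node a b then true :: prefix_code a ++ prefix_code b else [:: false].

(** There are no work symbols: trees are written with the input symbols [One] and [Zero]. *)
Definition cell : Type := (symbol + void)%type.

Definition token (b : bool) : cell := inl (if b then One else Zero).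

Definition tokens (x : tree) : seq cell := map token (prefix_code x).

Lemma token_top b : (Some (token b) == Some (token true)) = b.
Proof. by case: b; [exact: eqxx | apply/eqP]. Qed.

(* Four stacks: the input stack [tapeI] (a scratch stack once the input has been
   read), the main stack [tapeM] and two more scratch stacks. *)
Definition tapeI : 'I_4 := @Ordinal 4 0 isT.
Definition tapeM : 'I_4 := @Ordinal 4 1 isT.
Definition tapeR : 'I_4 := @Ordinal 4 2 isT.
Definition tapeC : 'I_4 := @Ordinal 4 3 isT.

Definition stacks4 (y m r c : seq cell) (i : 'I_4) : seq cell :=
  nth [::] [:: y; m; r; c] i.

Definition on_main (m : seq cell) := stacks4 [::] m [::] [::].

Definition is_top (i : 'I_4) (a : cell) (r : {ffun 'I_4 -> option cell}) : bool :=
  r i == Some a.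

Definition is_nonempty (i : 'I_4) (r : {ffun 'I_4 -> option cell}) : bool :=
  r i != None.

Lemma update_stacks4 y m r c x :
  (update (stacks4 y m r c) tapeI x = stacks4 x m r c) *
  (update (stacks4 y m r c) tapeM x = stacks4 y x r c) *
  (update (stacks4 y m r c) tapeR x = stacks4 y m x c) *
  (update (stacks4 y m r c) tapeC x = stacks4 y m r x).
Proof. by do !split; apply/funext => -[[|[|[|[|]]]]]. Qed.

Lemma fpush4 y m r c a :
  [/\ computes (fpush tapeI a) (stacks4 y m r c) (stacks4 (a :: y) m r c) 2,
      computes (fpush tapeM a) (stacks4 y m r c) (stacks4 y (a :: m) r c) 2,
      computes (fpush tapeR a) (stacks4 y m r c) (stacks4 y m (a :: r) c) 2 &
      computes (fpush tapeC a) (stacks4 y m r c) (stacks4 y m r (a :: c)) 2].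
Proof.
split.
- by rewrite -(update_stacks4 y m r c (a :: y)).1.1.1; apply: fpush_computes.
- by rewrite -(update_stacks4 y m r c (a :: m)).1.1.2; apply: fpush_computes.
- by rewrite -(update_stacks4 y m r c (a :: r)).1.2; apply: fpush_computes.
- by rewrite -(update_stacks4 y m r c (a :: c)).2; apply: fpush_computes.
Qed.

Lemma fpop4 y m r c :
  [/\ computes (fpop tapeI) (stacks4 y m r c) (stacks4 (behead y) m r c) 1,
      computes (fpop tapeM) (stacks4 y m r c) (stacks4 y (behead m) r c) 1,
      computes (fpop tapeR) (stacks4 y m r c) (stacks4 y m (behead r) c) 1 &
      computes (fpop tapeC) (stacks4 y m r c) (stacks4 y m r (behead c)) 1].
Proof.
split.
- by rewrite -(update_stacks4 y m r c (behead y)).1.1.1; apply: fpop_computes.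
- by rewrite -(update_stacks4 y m r c (behead m)).1.1.2; apply: fpop_computes.
- by rewrite -(update_stacks4 y m r c (behead r)).1.2; apply: fpop_computes.
- by rewrite -(update_stacks4 y m r c (behead c)).2; apply: fpop_computes.
Qed.

(** Tokens pushed one at a time arrive in reverse order, hence [catrev]; the flag says whether this
    scratch stack receives a copy. *)
Definition stash (b : bool) (e s : seq cell) : seq cell :=
  if b then catrev e s else s.

Lemma stash_cons b a e s : stash b (a :: e) s = stash b e (stash b [:: a] s).
Proof. by case: b. Qed.

Lemma stash_cat b e e' s : stash b (e ++ e') s = stash b e' (stash b e s).
Proof. by case: b => //=; elim: e s => //=. Qed.

(** A node replaces one pending subtree by two, a leaf removes one. *)
Definition grab_token (toR toI : bool) (b : bool) : fragment 4 cell :=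
  fseq (if b then fpush tapeC (token false) else fpop tapeC)
    (fseq (if toR then fpush tapeR (token b) else fskip)
       (fseq (if toI then fpush tapeI (token b) else fskip) (fpop tapeM))).

(* [tapeC] counts in unary the subtrees still to be read. *)
Definition grab_loop (toR toI : bool) : fragment 4 cell :=
  fwhile (is_nonempty tapeC)
    (fif (is_top tapeM (token true)) (grab_token toR toI true)
        (grab_token toR toI false)).

Definition grab (toR toI : bool) : fragment 4 cell :=
  fseq (fpush tapeC (token false)) (grab_loop toR toI).

Lemma grab_token_computes toR toI b y m r c :
  computes (fif (is_top tapeM (token true)) (grab_token toR toI true)
      (grab_token toR toI false))
    (stacks4 y (token b :: m) r (token false :: c))
    (stacks4 (stash toI [:: token b] y) m (stash toR [:: token b] r)
       (if b then [:: token false, token false & c] else c)) 8.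
Proof.
apply: fif_computes; rewrite /is_top ffunE.
rewrite token_top.
have -> : (if b then grab_token toR toI true else grab_token toR toI false) =
    grab_token toR toI b by case: b.
apply: (@computes_leq _ _ _ _ _ (2 + (2 + (2 + 1)))) => //.
apply: (fseq_computes (s2 := stacks4 y (token b :: m) r
    (if b then [:: token false, token false & c] else c))).
  case: b; first by case: (fpush4 y (token true :: m) r (token false :: c)
      (token false)).
  case: (fpop4 y (token false :: m) r (token false :: c)) => _ _ _.
  exact: (computes_leq (isT : 1 <= 2)).
set c' := if b then _ else _.
apply: (fseq_computes (s2 := stacks4 y (token b :: m) (stash toR [:: token b] r) c')).
  case: toR; first by case: (fpush4 y (token b :: m) r c' (token b)).
  exact: (computes_leq (isT : 1 <= 2) (@fskip_computes _ _ _)).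
apply: (fseq_computes (s2 := stacks4 (stash toI [:: token b] y) (token b :: m)
    (stash toR [:: token b] r) c')).
  case: toI; first by case: (fpush4 y (token b :: m) (stash toR [:: token b] r) c'
      (token b)).
  exact: (computes_leq (isT : 1 <= 2) (@fskip_computes _ _ _)).
by case: (fpop4 (stash toI [:: token b] y) (token b :: m) (stash toR [:: token b] r)
    c').
Qed.

(** The continuation form, from a run starting after the tree to a run starting before it, lets the
    induction chain the two subtrees of a node. Each token costs eight steps for the body and one
    for the loop test. *)
Lemma grab_loop_computes toR toI x y m r k s' t :
  let e := tokens x in
  computes (grab_loop toR toI)
    (stacks4 (stash toI e y) m (stash toR e r) (nseq k (token false))) s' t ->
  computes (grab_loop toR toI)
    (stacks4 y (e ++ m) r (nseq k.+1 (token false))) s' (t + 9 * size e).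
Proof.
rewrite /tokens; elim: x y m r k t => [|a IHa b IHb] y m r k t /= loop_t.
  rewrite muln1 -[t + 9]/(t + (8 + 1)) addnCA addn1 addnS.
  apply: fwhile_computes_loop loop_t; first by rewrite /is_nonempty ffunE.
  exact: (@grab_token_computes toR toI false _ _ _ _).
rewrite stash_cons (stash_cons toR) map_cat !stash_cat in loop_t.
move: loop_t => /IHb/IHa; rewrite catA -map_cat => loop_t.
apply: (@computes_leq _ _ _ _ _ (8 +
    (t + 9 * size (tokens b) + 9 * size (tokens a))).+1).
  by rewrite /tokens !size_map size_cat; lia.
apply: fwhile_computes_loop loop_t; first by rewrite /is_nonempty ffunE.
exact: (@grab_token_computes toR toI true _ _ _ _).
Qed.

Lemma grab_computes toR toI x y m r :
  computes (grab toR toI) (stacks4 y (tokens x ++ m) r [::])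
    (stacks4 (stash toI (tokens x) y) m (stash toR (tokens x) r) [::])
    (9 * size (tokens x) + 3).
Proof.
rewrite -[3]/(2 + 1) addnCA.
apply: (fseq_computes (s2 := stacks4 y (tokens x ++ m) r [:: token false])).
  by case: (fpush4 y (tokens x ++ m) r [::] (token false)).
rewrite addnC; apply: (grab_loop_computes (k := 0)).
by apply: fwhile_computes_stop; rewrite /is_nonempty ffunE.
Qed.

(** Pouring reverses once more, so a tree collected by [grab] comes back in its original order. *)
Definition pour (i : 'I_4) : fragment 4 cell :=
  fwhile (is_nonempty i)
    (fif (is_top i (token true)) (fseq (fpush tapeM (token true)) (fpop i))
       (fseq (fpush tapeM (token false)) (fpop i))).

Lemma pour_computes i e s : i != tapeM -> s i = map token e ->
  computes (pour i) s (update (update s i [::]) tapeM (catrev (map token e) (s tapeM)))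
    (5 * size e + 1).
Proof.
move=> tapeM'; elim: e s => [|b e IH] s s_i.
  have -> : update (update s i [::]) tapeM (catrev (map token [::]) (s tapeM)) = s.
    by apply/funext => j; rewrite /update; do !case: eqP => [->|_].
  by apply: fwhile_computes_stop; rewrite /is_nonempty ffunE s_i.
have -> : 5 * size (b :: e) + 1 = (4 + (5 * size e + 1)).+1 by rewrite /=; lia.
pose s1 := update (update s tapeM (token b :: s tapeM)) i (map token e).
apply: (@fwhile_computes_loop _ _ _ _ _ s1); rewrite /s1.
- by rewrite /is_nonempty ffunE s_i.
- apply: fif_computes; rewrite /is_top ffunE s_i /= token_top.
  have -> : (if b
    then fseq (fpush tapeM (token true)) (fpop i)
    else fseq (fpush tapeM (token false)) (fpop i)) = fseq (fpush tapeM (token b))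
        (fpop i).
    by case: b {s_i s1}.
  apply: (@fseq_computes _ _ _ _ _ (update s tapeM (token b :: s tapeM)) _ 2 1).
    exact: fpush_computes.
  have -> : map token e = behead (update s tapeM (token b :: s tapeM) i).
    by rewrite /update; case: eqP tapeM' => // _ _; rewrite s_i.
  exact: fpop_computes.
- have -> : update (update s i [::]) tapeM (catrev (map token (b :: e)) (s tapeM)) =
      update (update s1 i [::]) tapeM (catrev (map token e) (s1 tapeM)).
    apply/funext => j; rewrite /update /s1 /update eqxx.
    by rewrite [tapeM == i]eq_sym (negPf tapeM'); case: (j == tapeM) => //; case:
        (j == i).
  by apply: IH; rewrite /update eqxx.
Qed.

Lemma pourR y m e c :
  computes (pour tapeR) (stacks4 y m (map token e) c)
    (stacks4 y (catrev (map token e) m) [::] c) (5 * size e + 1).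
Proof.
by have := @pour_computes tapeR e (stacks4 y m (map token e) c) isT erefl; rewrite
    !update_stacks4.
Qed.

Lemma pourI m e r c :
  computes (pour tapeI) (stacks4 (map token e) m r c)
    (stacks4 [::] (catrev (map token e) m) r c) (5 * size e + 1).
Proof.
by have := @pour_computes tapeI e (stacks4 (map token e) m r c) isT erefl; rewrite
    !update_stacks4.
Qed.

Lemma catrev_token e m : catrev (map token (rev e)) m = map token e ++ m.
Proof. by rewrite map_rev catrevE revK. Qed.

Definition rev_tokens (x : tree) : seq cell := map token (rev (prefix_code x)).

Lemma stash_tokens x : stash true (tokens x) [::] = rev_tokens x.
Proof. by rewrite /= catrevE cats0 /rev_tokens map_rev. Qed.

Lemma pourR_tokens y m x :
  computes (pour tapeR) (stacks4 y m (rev_tokens x) [::])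
    (stacks4 y (tokens x ++ m) [::] [::]) (5 * size (tokens x) + 1).
Proof.
have := @pourR y m (rev (prefix_code x)) [::].
by rewrite catrev_token size_rev -(size_map token).
Qed.

Lemma pourI_tokens m r x :
  computes (pour tapeI) (stacks4 (rev_tokens x) m r [::])
    (stacks4 [::] (tokens x ++ m) r [::]) (5 * size (tokens x) + 1).
Proof.
have := @pourI m (rev (prefix_code x)) r [::].
by rewrite catrev_token size_rev -(size_map token).
Qed.

Definition fdup : fragment 4 cell := fseq (grab true true)
    (fseq (pour tapeR) (pour tapeI)).

Lemma fdup_computes x m :
  computes fdup (on_main (tokens x ++ m)) (on_main (tokens x ++ tokens x ++ m))
    (19 * size (tokens x) + 5).
Proof.
have := @grab_computes true true x [::] m [::]; rewrite !stash_tokens => g.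
have := fseq_computes g (fseq_computes (@pourR_tokens _ _ _) (@pourI_tokens _ _ _)).
by apply: computes_leq; lia.
Qed.

(** The first tree is parked on [tapeR], the second on [tapeI]; pouring [tapeR] first leaves the
    second tree on top. *)
Definition fswap : fragment 4 cell :=
  fseq (grab true false) (fseq (grab false true) (fseq (pour tapeR) (pour tapeI))).

Lemma fswap_computes x y m :
  computes fswap (on_main (tokens x ++ tokens y ++ m))
      (on_main (tokens y ++ tokens x ++ m))
    (14 * size (tokens x) + 14 * size (tokens y) + 8).
Proof.
have := @grab_computes true false x [::] (tokens y ++ m) [::].
rewrite stash_tokens => g1.
have := @grab_computes false true y [::] m (rev_tokens x); rewrite stash_tokens => g2.
have := fseq_computes g1
  (fseq_computes g2 (fseq_computes (@pourR_tokens _ _ _) (@pourI_tokens _ _ _))).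
by apply: computes_leq; lia.
Qed.

Definition fdrop : fragment 4 cell := grab false false.

Lemma fdrop_computes x m :
  computes fdrop (on_main (tokens x ++ m)) (on_main m) (9 * size (tokens x) + 3).
Proof. exact: (@grab_computes false false x [::] m [::]). Qed.

Lemma pushM a m : computes (fpush tapeM a) (on_main m) (on_main (a :: m)) 2.
Proof. by case: (fpush4 [::] m [::] [::] a). Qed.

Lemma popM a m : computes (fpop tapeM) (on_main (a :: m)) (on_main m) 1.
Proof. by case: (fpop4 [::] (a :: m) [::] [::]). Qed.

(** * Polynomial-time functions *)

Lemma leq_exp_l m n k : m <= n -> m ^ k <= n ^ k.
Proof. by case: k => // k; rewrite leq_exp2r. Qed.

(** As the base is at least 2, a single exponent absorbs constants, sums and products. *)
Definition poly_bounded (g : nat -> nat) : Prop :=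
  exists k, forall n, g n <= (n + 2) ^ k.

Lemma poly_bounded_const c : poly_bounded (fun _ => c).
Proof.
exists c => n; apply: (@leq_trans (2 ^ c)); first exact/ltnW/ltn_expl.
by apply: leq_exp_l; rewrite leq_addl.
Qed.

Lemma poly_bounded_id : poly_bounded id.
Proof. by exists 1 => n; rewrite expn1 leq_addr. Qed.

Lemma poly_bounded_add f g :
  poly_bounded f -> poly_bounded g -> poly_bounded (fun n => f n + g n).
Proof.
(* The extra exponent pays for the factor 2 in a sum of two terms below the same power. *)
move=> [j fj] [k gk]; exists (j + k).+1 => n.
have le_exp i l : (n + 2) ^ i <= (n + 2) ^ (i + l) by rewrite leq_exp2l ?leq_addr; lia.
have := le_exp j k; have := le_exp k j; have := fj n; have := gk n.
rewrite expnS [k + j]addnC; nia.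
Qed.

Lemma poly_bounded_mul f g :
  poly_bounded f -> poly_bounded g -> poly_bounded (fun n => f n * g n).
Proof. by move=> [j fj] [k gk]; exists (j + k) => n; rewrite expnD leq_mul. Qed.

Lemma poly_bounded_exp f k : poly_bounded f -> poly_bounded (fun n => f n ^ k).
Proof. by move=> [j fj]; exists (j * k) => n; rewrite expnM leq_exp_l. Qed.


Ltac poly_bound :=
  repeat first [ exact: poly_bounded_const | exact: poly_bounded_id
               | apply: poly_bounded_add | apply: poly_bounded_mul
               | apply: poly_bounded_exp | assumption ].

(** * Data coded as trees *)

Structure data := Data {carrier :> Type; code : carrier -> tree}.

Arguments code {d} x.

Definition word {T : data} (x : T) : seq cell := tokens (code x).

Definition len {T : data} (x : T) : nat := size (word x).

Canonical unit_data := @Data unit (fun _ => Leaf).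

Canonical bool_data := @Data bool (fun b => if b then Node Leaf Leaf else Leaf).

Canonical prod_data (T U : data) :=
  @Data (T * U)%type (fun x => Node (code x.1) (code x.2)).

(** A nonempty list has the code of the pair of its head and tail, and its first token tells it from
    the empty list. *)
Canonical seq_data (T : data) :=
  @Data (seq T) (foldr (fun x c => Node (code x) c) Leaf).

Lemma word_pair (T U : data) (x : T) (y : U) :
  word (x, y) = token true :: word x ++ word y.
Proof. by rewrite /word /tokens /= map_cat. Qed.

Lemma word_cons (T : data) (x : T) (s : seq T) :
  word (x :: s) = token true :: word x ++ word s.
Proof. exact: (word_pair x s). Qed.

Lemma len_pair (T U : data) (x : T) (y : U) : len (x, y) = (len x + len y).+1.
Proof. by rewrite /len word_pair /= size_cat. Qed.

Lemma len_cons (T : data) (x : T) (s : seq T) : len (x :: s) = (len x + len s).+1.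
Proof. exact: (len_pair x s). Qed.

Lemma len_nil (T : data) : len ([::] : seq T) = 1.
Proof. by []. Qed.

Lemma len_bool (b : bool) : len b = b.*2.+1.
Proof. by case: b. Qed.

(* Programs work on the top of the main stack and leave the rest unchanged, so
   that they can be composed. *)
Definition runs (F : fragment 4 cell) (T U : data) (x : T) (y : U) (t : nat) : Prop :=
  forall m, computes F (on_main (word x ++ m)) (on_main (word y ++ m)) t.

(** The output length is bounded along with the time, since in a composition the time of the second
    program depends on it. *)
Definition polytime (T U : data) (f : T -> U) : Prop :=
  exists F k, forall x, len (f x) <= (len x + 2) ^ k /\ runs F x (f x)
      ((len x + 2) ^ k).

Lemma polytimeI F g h (T U : data) (f : T -> U) :
  poly_bounded g -> poly_bounded h ->
  (forall x, len (f x) <= g (len x)) -> (forall x, runs F x (f x) (h (len x))) ->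
  polytime f.
Proof.
move=> [j gj] [k hk] len_f Ff; exists F, (j + k) => x.
have le_exp i l : (len x + 2) ^ i <= (len x + 2) ^ (i + l).
  by rewrite leq_exp2l ?leq_addr; lia.
split; first exact: leq_trans (leq_trans (len_f x) (gj _)) (le_exp _ _).
move=> m; apply: computes_leq (Ff x m); apply: leq_trans (hk _) _.
by rewrite [j + k]addnC le_exp.
Qed.

Lemma polytime_id (T : data) : polytime (fun x : T => x).
Proof.
apply: (@polytimeI fskip id (fun _ => 1)) => //; try by poly_bound.
by move=> x m; apply: fskip_computes.
Qed.

Lemma polytime_comp (T U V : data) (f : T -> U) (g : U -> V) :
  polytime f -> polytime g -> polytime (fun x => g (f x)).
Proof.
move=> [F [j Ff]] [G [k Gg]].
pose b n := ((n + 2) ^ j + 2) ^ k.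
have bP x : (len (f x) + 2) ^ k <= b (len x).
  by apply: leq_exp_l; rewrite leq_add2r; case: (Ff x).
apply: (@polytimeI (fseq F G) b (fun n => (n + 2) ^ j + b n)); rewrite /b; try by
    poly_bound.
  by move=> x; apply: leq_trans (bP x); case: (Gg (f x)).
move=> x m; have [_ Fx] := Ff x; have [_ Gx] := Gg (f x).
apply: fseq_computes (Fx m) (computes_leq _ (Gx m)); exact: bP.
Qed.

Lemma polytime_pair (T U V : data) (f : T -> U) (g : T -> V) :
  polytime f -> polytime g -> polytime (fun x => (f x, g x)).
Proof.
move=> [F [j Ff]] [G [k Gg]].
pose b n := (19 * n + 5) + ((n + 2) ^ j + ((14 * (n + 2) ^ j + 14 * n + 8)
  + ((n + 2) ^ k + ((14 * (n + 2) ^ k + 14 * (n + 2) ^ j + 8) + 2)))).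
(* The stack reads [x x], then [f x, x], then [x, f x], then [g x, f x], then [f x, g x]; the last
   push adds the node of the pair. *)
apply: (@polytimeI (fseq fdup (fseq F
    (fseq fswap (fseq G (fseq fswap (fpush tapeM (token true))))))) b b);
  rewrite /b; try by poly_bound.
  by move=> x; rewrite len_pair; have [? _] := Ff x; have [? _] := Gg x; lia.
move=> x m; have [lenf Fx] := Ff x; have [leng Gx] := Gg x.
rewrite word_pair /= -catA.
apply: fseq_computes (@fdup_computes _ _) _.
apply: fseq_computes (Fx _) _.
apply: fseq_computes (computes_leq _ (@fswap_computes _ _ _)) _; first by move: lenf;
    rewrite /len /word; lia.
apply: fseq_computes (Gx _) _.
apply: fseq_computes (computes_leq _ (@fswap_computes _ _ _)) _; last exact: pushM.
by move: lenf leng; rewrite /len /word; lia.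
Qed.

Lemma polytime_fst (T U V : data) (f : T -> U * V) :
  polytime f -> polytime (fun x => (f x).1).
Proof.
move=> Pf; apply: (polytime_comp (g := fst) Pf) => {Pf f}.
pose b n := 1 + ((14 * n + 14 * n + 8) + (9 * n + 3)).
apply: (@polytimeI (fseq (fpop tapeM) (fseq fswap fdrop)) b b); rewrite /b; try by
    poly_bound.
  by case=> x y; rewrite len_pair /=; lia.
case=> x y m; rewrite word_pair /= -catA len_pair.
apply: fseq_computes (@popM _ _) _.
apply: fseq_computes (computes_leq _ (@fswap_computes _ _ _)) _.
  by rewrite -!/(word _) -!/(len _); lia.
by apply: computes_leq (@fdrop_computes _ _); rewrite -!/(word _) -!/(len _); lia.
Qed.

Lemma polytime_snd (T U V : data) (f : T -> U * V) :
  polytime f -> polytime (fun x => (f x).2).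
Proof.
move=> Pf; apply: (polytime_comp (g := snd) Pf) => {Pf f}.
pose b n := 1 + (9 * n + 3).
apply: (@polytimeI (fseq (fpop tapeM) fdrop) b b); rewrite /b; try by poly_bound.
  by case=> x y; rewrite len_pair /=; lia.
case=> x y m; rewrite word_pair /= -catA len_pair.
apply: fseq_computes (@popM _ _) _.
by apply: computes_leq (@fdrop_computes _ _); rewrite -!/(word _) -!/(len _); lia.
Qed.

Fixpoint fpushes (s : seq cell) : fragment 4 cell :=
  if s is a :: s1 then fseq (fpushes s1) (fpush tapeM a) else fskip.

Lemma fpushes_computes s y m r c :
  computes (fpushes s) (stacks4 y m r c) (stacks4 y (s ++ m) r c) (2 * size s + 1).
Proof.
elim: s => [|a s IH] /=; first exact: fskip_computes.
have -> : 2 * (size s).+1 + 1 = 2 * size s + 1 + 2 by lia.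
by apply: fseq_computes IH _; case: (fpush4 y (s ++ m) r c a).
Qed.

Lemma polytime_const (T U : data) (y : U) : polytime (fun _ : T => y).
Proof.
pose b n := (9 * n + 3) + (2 * len y + 1).
apply: (@polytimeI (fseq fdrop (fpushes (word y))) (fun _ => len y) b);
  rewrite /b; try by poly_bound.
by move=> x m; apply: fseq_computes (@fdrop_computes _ _) (@fpushes_computes _ _ _ _ _).
Qed.

(** The program computes [(l x, x)] and pops the pair token, which exposes the first token of [l x].
    For a nonempty list, pushing a node token gives [((b, s), x)], because a list has the code of a
    pair; otherwise a second pop leaves [x]. *)
Lemma polytime_case (T B U : data) (l : T -> seq B) (f : T -> U)
    (g : T -> B -> seq B -> U) :
  polytime l -> polytime f -> polytime (fun z : (B * seq B) * T => g z.2 z.1.1 z.1.2) ->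
  polytime (fun x => if l x is b :: s then g x b s else f x).
Proof.
move=> Pl [F [j Ff]] [G [k Gg]].
have [P [i Pp]] := polytime_pair Pl (@polytime_id T).
pose b n := (n + 2) ^ i + (1 + (n + 2) ^ j + ((n + 2) ^ i + 2) ^ k + 3).
apply: (@polytimeI (fseq P (fseq (fpop tapeM) (fif (is_top tapeM (token true))
    (fseq (fpush tapeM (token true)) G) (fseq (fpop tapeM) F)))) b (fun n => b n + 1));
  rewrite /b; try by poly_bound.
  move=> x; have [+ _] := Pp x; case: (l x) => [|c s] lenP; first by have [? _] := Ff
      x; lia.
  have [le_g _] := Gg ((c, s), x); apply: leq_trans le_g _.
  have : (len ((c, s), x) + 2) ^ k <= ((len x + 2) ^ i + 2) ^ k.
    by apply: leq_exp_l; rewrite leq_add2r.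
  by lia.
move=> x m; have [lenP Px] := Pp x; have {}Px := Px m; set V := word
    (if _ is _ :: _ then _ else _).

rewrite -addnA; apply: fseq_computes Px _; rewrite {}/V.
case: (l x) lenP => [|c s] lenP; rewrite word_pair.
  apply: (@computes_leq _ _ _ _ _ (1 + (1 + (len x + 2) ^ j).+1)); first by lia.
  apply: fseq_computes (@popM _ _) _; apply: fif_computes.
  rewrite /is_top ffunE /= token_top; apply: fseq_computes (@popM _ _) _.
  by have [_ Fx] := Ff x; apply: Fx.
have le_k : (len ((c, s), x) + 2) ^ k <= ((len x + 2) ^ i + 2) ^ k.
  by apply: leq_exp_l; rewrite leq_add2r.
apply: (@computes_leq _ _ _ _ _ (1 + (2 + ((len x + 2) ^ i + 2) ^ k).+1)); first by lia.
apply: fseq_computes (@popM _ _) _; apply: fif_computes.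
rewrite /is_top ffunE /= token_top; apply: fseq_computes (@pushM _ _) _.
rewrite -[_ :: _]/((token true :: word (c :: s) ++ word x) ++ m).
rewrite -[word (c :: s)]/(word (c, s)) -word_pair.
by have [_ Gx] := Gg ((c, s), x); apply: computes_leq (Gx m).
Qed.

Lemma polytime_if (T U : data) (b : T -> bool) (f g : T -> U) :
  polytime b -> polytime f -> polytime g -> polytime
      (fun x => if b x then f x else g x).
Proof.
move=> Pb Pf Pg; pose l x : seq unit := nseq (b x) tt.
(* A Boolean has the code of the list with one or no [tt], so the program for [b] also computes
   [l]. *)
have Pl : polytime l.
  have [F [k Fb]] := Pb; exists F, k => x; move: (Fb x); rewrite /runs /len /l.
  by case: (b x).
suff -> : (fun x => if b x then f x else g x) = fun x => if l x is _ :: _ then f x else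
    g x.
  by apply: polytime_case Pl Pg _; apply: polytime_comp Pf;
      apply/polytime_snd/polytime_id.
by apply/funext => x; rewrite /l; case: (b x).
Qed.

Lemma polytime_cons (T B : data) (f : T -> B) (g : T -> seq B) :
  polytime f -> polytime g -> polytime (fun x => f x :: g x).
Proof. exact: polytime_pair. Qed.

Lemma polytime_head (T B : data) (b0 : B) (f : T -> seq B) :
  polytime f -> polytime (fun x => head b0 (f x)).
Proof.
move=> Pf; apply: (polytime_case (g := fun _ b _ => b) Pf (polytime_const _ b0)).
by do 2 apply: polytime_fst; apply: polytime_id.
Qed.

Lemma polytime_behead (T B : data) (f : T -> seq B) :
  polytime f -> polytime (fun x => behead (f x)).
Proof.
move=> Pf; apply: (polytime_case (g := fun _ _ s => s) Pf (polytime_const _ [::])).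
by apply: polytime_snd; apply: polytime_fst; apply: polytime_id.
Qed.

Lemma polytime_nilp (T B : data) (f : T -> seq B) :
  polytime f -> polytime (fun x => nilp (f x)).
Proof.
move=> Pf; suff -> : (fun x => nilp (f x)) =
    (fun x => if f x is _ :: _ then false else true).
  apply: (polytime_case (g := fun _ _ _ => false) Pf); exact: polytime_const.
by apply/funext => x; case: (f x).
Qed.

(** * Folds over lists *)

Section Foldl.

Variables (T B C : data) (step : T -> B -> C -> C).
Variables (body : fragment 4 cell) (k : nat).

Hypothesis bodyP : forall (b : B) (s : seq B) (c : C) (x : T),
  runs body ((b, s), (c, x)) (s, (step x b c, x)) ((len ((b, s), (c, x)) + 2) ^ k).

Let loop :=
  fwhile (is_top tapeM (token true))
      (fseq (fpush tapeM (token true)) (fseq body (fpop tapeM))).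

(* The value [(s, (c, x))] is kept on the main stack without its first token, so
   that the loop can test whether [s] is empty. *)
Lemma fold_loop_computes (x : T) (s : seq B) (c : C) (n : nat) (m : seq cell) :
  (forall s1 s2, s = s1 ++ s2 -> len (s2, (foldl (fun c b => step x b c) c s1, x)) <=
      n) ->
  computes loop (on_main (word s ++ word (c, x) ++ m))
    (on_main (token false :: word (foldl (fun c b => step x b c) c s, x) ++ m))
    (size s * ((n + 2) ^ k + 4) + 1).
Proof.
elim: s c => [|b s IH] c le_n.
  rewrite mul0n; apply: fwhile_computes_stop.
  by rewrite /is_top ffunE /= token_top.
have -> : size (b :: s) * ((n + 2) ^ k + 4) + 1 =
    ((2 + ((n + 2) ^ k + 1)) + (size s * ((n + 2) ^ k + 4) + 1)).+1.
  by rewrite /=; lia.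
apply: (fwhile_computes_loop _ _ (IH (step x b c) _)); last 1 first.
- by move=> s1 s2 s_eq; apply: (le_n (b :: s1)); rewrite s_eq.
- by rewrite /is_top ffunE /= token_top.
apply: fseq_computes (@pushM _ _) _.
have run := @bodyP b s c x m.
rewrite (word_pair (b, s)) (word_pair s) !cat_cons -!catA in run.
apply: fseq_computes (computes_leq _ run) (@popM _ _).
apply: leq_exp_l; rewrite leq_add2r; exact: (le_n [::] (b :: s) erefl).
Qed.

End Foldl.

Lemma size_le_len (T : data) (s : seq T) : size s <= len s.
Proof. by elim: s => //= x s IH; rewrite len_cons; lia. Qed.

Lemma len_cat (T : data) (s1 s2 : seq T) : (len (s1 ++ s2)).+1 = len s1 + len s2.
Proof. by elim: s1 => [|x s IH] //=; rewrite !len_cons; lia. Qed.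

(* The increase must not depend on the accumulator, whose size could otherwise
   grow exponentially. *)
Lemma polytime_foldl j (T B C : data) (l : T -> seq B) (init : T -> C)
    (step : T -> B -> C -> C) :
  (forall x b c, len (step x b c) <= len c + (len x + len b + 2) ^ j) ->
  polytime l -> polytime init -> polytime (fun z : T * (B * C) => step z.1 z.2.1 z.2.2)
      ->
  polytime (fun x => foldl (fun c b => step x b c) (init x) (l x)).
Proof.
move=> len_step Pl Pinit Pstep.
have len_fold x s c : len (foldl (fun c b => step x b c) c s)
    <= len c + len s * (len x + len s + 2) ^ j.
  apply: (@leq_trans (len c + size s * (len x + len s + 2) ^ j)); last first.
    by rewrite leq_add2l leq_mul2r size_le_len orbT.
  elim: s c => [|b s IH] c /=; first by rewrite mul0n addn0.
  apply: leq_trans (IH _) _; rewrite len_cons.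
  have := len_step x b c.
  have : (len x + len b + 2) ^ j <= (len x + (len b + len s).+1 + 2) ^ j by apply:
      leq_exp_l; lia.
  have : (len x + len s + 2) ^ j <= (len x + (len b + len s).+1 + 2) ^ j by apply:
      leq_exp_l; lia.
  nia.
have [body [k bodyP]] : polytime (fun z : (B * seq B) * (C * T) =>
    (z.1.2, (step z.2.2 z.1.1 z.2.1, z.2.2))).
  apply: polytime_pair; first by apply/polytime_snd/polytime_fst/polytime_id.
  apply: polytime_pair; last by do 2 apply/polytime_snd; apply: polytime_id.
  apply: (polytime_comp (f := fun z : (B * seq B) * (C * T) => (z.2.2, (z.1.1, z.2.1)))
      _ Pstep).
  apply: polytime_pair; first by do 2 apply/polytime_snd; apply: polytime_id.
  apply: polytime_pair; first by do 2 apply/polytime_fst; apply: polytime_id.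
  by apply/polytime_fst/polytime_snd/polytime_id.
have Pprep : polytime (fun x => (l x, (init x, x))).
  by apply: polytime_pair => //; apply: polytime_pair => //; apply: polytime_id.
pose final (z : seq B * (C * T)) : seq B * (C * T) :=
  ([::], (foldl (fun c b => step z.2.2 b c) z.2.1 z.1, z.2.2)).
suff Pfinal : polytime final.
  by apply: (polytime_fst (f := fun x => (final (l x, (init x, x))).2));
    apply: polytime_snd; apply: (polytime_comp Pprep Pfinal).
(* A bound on the length of every intermediate state of the loop, hence on the time of each pass. *)
pose b n := n + n * (2 * n + 2) ^ j.
have le_b s1 s2 c x : len (s2, (foldl (fun c b => step x b c) c s1, x)) <= b
    (len (s1 ++ s2, (c, x))).
  rewrite /b !len_pair; have := len_cat s1 s2; have := len_fold x s1 c.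
  set n := (len (s1 ++ s2) + _).+1 => le1 le2.
  have : (len x + len s1 + 2) ^ j <= (2 * n + 2) ^ j by apply: leq_exp_l; lia.
  have : 0 < len s2 by rewrite /len /word; case: (code s2).
  nia.
pose loop := fwhile (is_top tapeM (token true))
    (fseq (fpush tapeM (token true)) (fseq body (fpop tapeM))).
apply: (@polytimeI (fseq (fpop tapeM) (fseq loop (fpush tapeM (token true)))) b
  (fun n => 1 + ((n * ((b n + 2) ^ k + 4) + 1) + 2))); rewrite /b; try by poly_bound.
  by case=> s [c x]; have := le_b s [::] c x; rewrite cats0.
case=> s [c x] m; rewrite (word_pair s) (word_pair [::]) !cat_cons -!catA.
apply: fseq_computes (@popM _ _) (fseq_computes _ (@pushM _ _)).
set n := len (s, (c, x)).
apply: computes_leq (@fold_loop_computes _ _ _ step body k _ x s c (b n) m _).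
- by rewrite leq_add2r leq_mul2r -/(b n) (leq_trans (size_le_len s)) ?orbT // /n
    len_pair; lia.
- by move=> b' s' c' x'; case: (bodyP ((b', s'), (c', x'))).
- by move=> s1 s2 s_eq; rewrite /n s_eq; apply: le_b.
Qed.

(** * Boolean tests, searches in lists and equality *)

Lemma len_gt0 (T : data) (x : T) : 0 < len x.
Proof. by rewrite /len /word; case: (code x). Qed.

Lemma len_behead (T : data) (s : seq T) : len (behead s) <= len s.
Proof. by case: s => //= x s; rewrite len_cons; lia. Qed.

Lemma len_bool_le (b : bool) : len b <= 3.
Proof. by case: b. Qed.

Lemma polytime_andb (T : data) (f g : T -> bool) :
  polytime f -> polytime g -> polytime (fun x => f x && g x).
Proof. by move=> Pf Pg; apply: polytime_if Pf Pg (polytime_const _ _). Qed.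

Lemma polytime_orb (T : data) (f g : T -> bool) :
  polytime f -> polytime g -> polytime (fun x => f x || g x).
Proof. by move=> Pf Pg; apply: polytime_if Pf (polytime_const _ _) Pg. Qed.

Lemma polytime_negb (T : data) (f : T -> bool) :
  polytime f -> polytime (fun x => ~~ f x).
Proof. by move=> Pf; apply: polytime_if Pf (polytime_const _ _) (polytime_const _ _).
    Qed.

Lemma polytime_eqb (T : data) (f g : T -> bool) :
  polytime f -> polytime g -> polytime (fun x => f x == g x).
Proof.
move=> Pf Pg; suff -> : (fun x => f x == g x) = (fun x => if f x then g x else ~~ g x).
  by apply: polytime_if Pf Pg (polytime_negb Pg).
by apply/funext => x; case: (f x); case: (g x).
Qed.

Ltac polytime_tac := repeat match goal with
  | H : polytime ?f |- polytime ?f => exact: H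
  | |- polytime fst => apply: (polytime_fst (f := id))
  | |- polytime snd => apply: (polytime_snd (f := id))
  | |- polytime id => exact: polytime_id
  | |- polytime (fun x => x) => exact: polytime_id
  | |- polytime (fun x => fst (@?f x)) => apply: polytime_fst
  | |- polytime (fun x => snd (@?f x)) => apply: polytime_snd
  | |- polytime (fun x => (@?f x, @?g x)) => apply: polytime_pair
  | |- polytime (fun x => @?f x :: @?g x) => apply: polytime_cons
  | |- polytime (fun x => @?f x && @?g x) => apply: polytime_andb
  | |- polytime (fun x => @?f x || @?g x) => apply: polytime_orb
  | |- polytime (fun x => ~~ (@?f x)) => apply: polytime_negb
  | |- polytime (fun x => nilp (@?f x)) => apply: polytime_nilp
  | |- polytime (fun x => behead (@?f x)) => apply: polytime_behead
  | |- polytime (fun x => head _ (@?f x)) => apply: polytime_head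
  | _ => exact: polytime_const
  | _ => apply: polytime_if
  end.

Lemma polytime_has (T B : data) (P : T -> B -> bool) (s : T -> seq B) :
  polytime (fun z : T * B => P z.1 z.2) -> polytime s -> polytime
      (fun x => has (P x) (s x)).
Proof.
move=> PP Ps; suff -> : (fun x => has (P x) (s x)) =
    (fun x => foldl (fun c b => c || P x b) false (s x)).
  apply: (@polytime_foldl 2 _ _ _ s (fun=> false) (fun x b c => c || P x b)) => //.
  - move=> x b c; rewrite !len_bool; have : 2 ^ 2 <= (len x + len b + 2) ^ 2 by apply:
      leq_exp_l; lia.
    by case: c; case: (P x b); lia.
  - exact: polytime_const.
  - apply: polytime_orb; first by polytime_tac.
    by apply: (polytime_comp (f := fun z : T * (B * bool) => (z.1, z.2.1)) _ PP);
        polytime_tac.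
apply/funext => x; rewrite -[has _ _]orFb; elim: (s x) false => [|b t IH] c //=.
  by rewrite orbF.
by rewrite orbA IH.
Qed.

Lemma polytime_all (T B : data) (P : T -> B -> bool) (s : T -> seq B) :
  polytime (fun z : T * B => P z.1 z.2) -> polytime s -> polytime
      (fun x => all (P x) (s x)).
Proof.
move=> PP Ps; suff -> : (fun x => all (P x) (s x)) =
    (fun x => ~~ has (fun b => ~~ P x b) (s x)).
  by apply: polytime_negb; apply: polytime_has => //; apply: polytime_negb.
by apply/funext => x; rewrite -all_predC; apply: eq_all => b /=; rewrite negbK.
Qed.

(** Equality of words as a fold over the first word that consumes the second. *)
Definition eq_bits (s t : seq bool) : bool :=
  let z := foldl (fun z b => (z.1 && (~~ nilp z.2 && (head false z.2 == b)), behead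
      z.2))
    (true, t) s in z.1 && nilp z.2.

Lemma eq_bitsE s t : eq_bits s t = (s == t).
Proof.
rewrite /eq_bits -[RHS]andTb; elim: s t true => [|b s IH] [|a t] c //=.
  by rewrite IH andbF.
by rewrite IH eqseq_cons [a == b]eq_sym andbA.
Qed.

Lemma polytime_eq_bits (T : data) (f g : T -> seq bool) :
  polytime f -> polytime g -> polytime (fun x => f x == g x).
Proof.
move=> Pf Pg; suff -> : (fun x => f x == g x) = (fun x => eq_bits (f x) (g x)).
  pose step (x : T) (b : bool) (z : bool * seq bool) :=
    (z.1 && (~~ nilp z.2 && (head false z.2 == b)), behead z.2).
  suff Pz : polytime (fun x => foldl (fun z b => step x b z) (true, g x) (f x)).
    by apply: polytime_andb; [apply: polytime_fst | apply/polytime_nilp/polytime_snd].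
  apply: (@polytime_foldl 2) => //; rewrite /step.
  - move=> x b [c s] /=; rewrite !len_pair.
    have le4 : 2 ^ 2 <= (len x + len b + 2) ^ 2 by apply: leq_exp_l; lia.
    have len_c := len_gt0 c.
    apply: (@leq_ltn_trans (3 + len s)); last by lia.
    exact: leq_add (len_bool_le _) (len_behead s).
  - by polytime_tac.
  - by polytime_tac; apply: polytime_eqb; polytime_tac.
by apply/funext => x; rewrite eq_bitsE.
Qed.

Definition bits (n : nat) : seq bool :=
  [seq if s is One then true else false | s <- encode_nat n].

Lemma bits_inj : injective bits.
Proof.
have pos_inj p q : [seq if s is One then true else false | s <- encode_positive p] =
    [seq if s is One then true else false | s <- encode_positive q] -> p = q.
  have nz p' : [seq if s is One then true else false | s <- encode_positive p'] <> [::]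
      by case: p'.
  elim: p q => [p IH|p IH|] [q|q|] //= [] => [/IH -> //|/nz //|/IH -> //|/esym/nz //].
move=> m n; rewrite /bits /encode_nat => bits_eq.
apply: (can_inj bin_of_natK); case: (bin_of_nat m) (bin_of_nat n) bits_eq => [|p] [|q]
    //=.
- by case: q.
- by case: p.
- by move=> /pos_inj ->.
Qed.

(** A number and its word of bits have the same code, so a program cannot tell them apart and a test
    on bits is a test on numbers. *)
Canonical nat_data := @Data nat (fun n => code (bits n)).

Lemma polytime_eqn (T : data) (f g : T -> nat) :
  polytime f -> polytime g -> polytime (fun x => f x == g x).
Proof.
move=> Pf Pg; suff -> : (fun x => f x == g x) = (fun x => bits (f x) == bits (g x)).
  exact: (@polytime_eq_bits T (fun x => bits (f x)) (fun x => bits (g x)) Pf Pg).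
by apply/funext => x; apply/esym/inj_eq/bits_inj.
Qed.

Lemma polytime_mem (T : data) (f : T -> literal) (s : T -> seq literal) :
  polytime (f : T -> bool * nat) -> polytime (s : T -> seq (bool * nat)) ->
  polytime (fun x => f x \in s x).
Proof.
move=> Pf Ps; suff -> : (fun x => f x \in s x) =
    (fun x => has (fun l : bool * nat => ((f x).1 == l.1) && ((f x).2 == l.2)) (s x)).
  apply: (polytime_has (P := fun x (l : bool * nat) => ((f x).1 == l.1) &&
      ((f x).2 == l.2))) => //.
  have Pf1 : polytime (fun z : T * (bool * nat) => f z.1).
    by apply: (polytime_comp (f := fst) _ Pf); polytime_tac.
  by apply: polytime_andb; [apply: polytime_eqb | apply: polytime_eqn]; polytime_tac.
apply/funext => x; rewrite -has_pred1; apply: eq_has => -[b n] /=.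
by rewrite -pair_eqE /pair_eq /= eq_sym [n == _]eq_sym.
Qed.

(** * The decision procedure *)

(** Premises are literals here, so that facts, premises and conclusions share one type; those that
    come from defaults are positive. *)
Definition rule : Type := (seq literal * literal)%type.

Definition neg (l : literal) : literal := (~~ l.1, l.2).

Definition consistent (L : seq literal) : bool := all (fun l => neg l \notin L) L.

Definition known (W : seq literal) (A : seq rule) : seq literal :=
  foldl (fun B (h : rule) => h.2 :: B) W A.

(** The set [B] only blocks: premises must lie in [S], so a kept conclusion that has not been
    derived supports nothing. *)
Definition fires (B S : seq literal) (h : rule) : bool :=
  [&& h.2.1, neg h.2 \notin B & all (fun l => l \in S) h.1].

Definition closure_pass (D : seq rule) (B S : seq literal) : seq literal :=
  foldl (fun S h => if fires B S h then h.2 :: S else S) S D.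

(* As many passes as rules are enough to reach a fixpoint. *)
Definition rule_closure (D : seq rule) (B W : seq literal) : seq literal :=
  foldl (fun S (_ : rule) => closure_pass D B S) W D.

(* Whether some extension applies all the rules of [A]. *)
Definition feasible (D : seq rule) (W : seq literal) (A : seq rule) : bool :=
  consistent (known W A) &&
  all (fun h : rule => all (fun l => l \in rule_closure D (known W A) W) h.1) A.

Definition greedy (D : seq rule) (W : seq literal) : seq rule :=
  foldl (fun A h => if feasible D W (h :: A) then h :: A else A) [::] D.

(** The first disjunct covers an inconsistent [W], for which an extension contains every formula. *)
Definition decide (z : seq rule * (seq literal * seq literal)) : bool :=
  ~~ consistent z.2.1 ||
  has (fun l => (l \in known z.2.1 (greedy z.1 z.2.1)) || (neg l \in z.2.2)) z.2.2.

(** * The decision procedure runs in polynomial time *)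

Section DecidePolytime.

Let literalD := prod_data bool_data nat_data.
Let ruleD := prod_data (seq_data literalD) literalD.

Lemma polytime_neg (T : data) (f : T -> literalD) :
  polytime f -> polytime ((fun x => neg (f x)) : T -> literalD).
Proof. by move=> Pf; rewrite /neg; polytime_tac. Qed.

Lemma polytime_known (T : data) (W : T -> seq literalD) (A : T -> seq ruleD) :
  polytime W -> polytime A -> polytime
      ((fun x => known (W x) (A x)) : T -> seq literalD).
Proof.
move=> PW PA; apply: (@polytime_foldl 1 T ruleD (seq_data literalD) A W
    (fun _ h B => h.2 :: B)) => //.
  by move=> x [ps l] B /=; rewrite len_cons len_pair; lia.
by polytime_tac.
Qed.

Lemma polytime_consistent (T : data) (L : T -> seq literalD) :
  polytime L -> polytime (fun x => consistent (L x)).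
Proof.
move=> PL; apply: (@polytime_all T literalD (fun x l => neg l \notin L x)) => //.
apply: polytime_negb; apply: polytime_mem; first by apply: polytime_neg; polytime_tac.
by apply: polytime_comp PL; polytime_tac.
Qed.

Lemma polytime_fires (T : data) (B S : T -> seq literalD) (h : T -> ruleD) :
  polytime B -> polytime S -> polytime h -> polytime (fun x => fires (B x) (S x) (h x)).
Proof.
move=> PB PS Ph; apply: polytime_andb; first by polytime_tac.
apply: polytime_andb.
  by apply: polytime_negb; apply: polytime_mem => //; apply: polytime_neg; polytime_tac.
apply: (@polytime_all T literalD (fun x l => l \in S x)); last by polytime_tac.
by apply: polytime_mem; [|apply: polytime_comp PS]; polytime_tac.
Qed.

(** A rule adds its conclusion at most once per pass. The growth is thus independent of [S], as the
    outer fold over passes requires. *)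
Lemma len_closure_pass (D : seq ruleD) (B S : seq literalD) :
  len (closure_pass D B S : seq literalD) <= len S + len D.
Proof.
rewrite /closure_pass; elim: D S => [|[ps l] D IH] S /=; first by rewrite leq_addr.
apply: leq_trans (IH _) _; rewrite (@len_cons ruleD)
    (@len_pair (seq_data literalD) literalD).
by case: (fires _ _ _); rewrite ?(@len_cons literalD) /=; lia.
Qed.

Lemma polytime_closure_pass (T : data) (D : T -> seq ruleD) (B S : T -> seq literalD) :
  polytime D -> polytime B -> polytime S ->
  polytime ((fun x => closure_pass (D x) (B x) (S x)) : T -> seq literalD).
Proof.
move=> PD PB PS.
apply: (@polytime_foldl 1 T ruleD (seq_data literalD) D S
  (fun x h S => if fires (B x) S h then h.2 :: S else S)) => //.
  move=> x [ps l] S' /=; rewrite (@len_pair (seq_data literalD) literalD) expn1.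
  by case: (fires _ _ _); rewrite ?(@len_cons literalD) /=; lia.
apply: polytime_if; [apply: polytime_fires|..]; polytime_tac.
by apply: polytime_comp PB; polytime_tac.
Qed.

Lemma polytime_closure (T : data) (D : T -> seq ruleD) (B W : T -> seq literalD) :
  polytime D -> polytime B -> polytime W ->
  polytime ((fun x => rule_closure (D x) (B x) (W x)) : T -> seq literalD).
Proof.
move=> PD PB PW; have [F [k Dk]] := PD.
apply: (@polytime_foldl k T ruleD (seq_data literalD) D W
  (fun x _ S => closure_pass (D x) (B x) S)) => //.
  move=> x h S; apply: leq_trans (len_closure_pass _ _ _) _; rewrite leq_add2l.
  have [le_D _] := Dk x; apply: leq_trans le_D _; apply: leq_exp_l; lia.
apply: polytime_closure_pass; last by polytime_tac.
- by apply: polytime_comp PD; polytime_tac.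
- by apply: polytime_comp PB; polytime_tac.
Qed.

Lemma polytime_feasible (T : data) (D : T -> seq ruleD) (W : T -> seq literalD)
    (A : T -> seq ruleD) :
  polytime D -> polytime W -> polytime A ->
  polytime (fun x => feasible (D x) (W x) (A x)).
Proof.
move=> PD PW PA; apply: polytime_andb.
  by apply: polytime_consistent; apply: polytime_known.
pose S x : seq literalD := rule_closure (D x) (known (W x) (A x)) (W x).
have PS : polytime S by apply: polytime_closure => //; apply: polytime_known.
apply: (@polytime_all T ruleD (fun x h => all (fun l => l \in S x) h.1)) => //.
apply: (@polytime_all (prod_data T ruleD) literalD (fun z l => l \in S z.1)); last by
    polytime_tac.
apply: polytime_mem; first by polytime_tac.
by apply: (polytime_comp (f := fun z : T * ruleD * literalD => z.1.1) _ PS);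
    polytime_tac.
Qed.

Lemma polytime_greedy (T : data) (D : T -> seq ruleD) (W : T -> seq literalD) :
  polytime D -> polytime W -> polytime ((fun x => greedy (D x) (W x)) : T -> seq ruleD).
Proof.
move=> PD PW.
apply: (@polytime_foldl 1 T ruleD (seq_data ruleD) D (fun=> [::])
  (fun x h A => if feasible (D x) (W x) (h :: A) then h :: A else A)) => //.
- by move=> x h A; rewrite expn1; case: (feasible _ _ _); rewrite ?(@len_cons ruleD);
    lia.
- exact: polytime_const.
apply: polytime_if; [apply: polytime_feasible|..]; polytime_tac.
- by apply: (polytime_comp (f := fst) _ PD); polytime_tac.
- by apply: (polytime_comp (f := fst) _ PW); polytime_tac.
Qed.

Lemma polytime_decide :
  polytime (decide : seq ruleD * (seq literalD * seq literalD) -> bool).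
Proof.
apply: polytime_orb; first by apply/polytime_negb/polytime_consistent; polytime_tac.
pose T := prod_data (seq_data ruleD)
    (prod_data (seq_data literalD) (seq_data literalD)).
pose B (z : T) : seq literalD := known z.2.1 (greedy z.1 z.2.1).
have PB : polytime B.
  by apply: polytime_known; [|apply: polytime_greedy]; polytime_tac.
apply: (@polytime_has T literalD (fun z l => (l \in B z) || (neg l \in z.2.2))); last
    by polytime_tac.
apply: polytime_orb; apply: polytime_mem; try by polytime_tac.
  by apply: (polytime_comp (f := fst) _ PB); polytime_tac.
by apply: polytime_neg; polytime_tac.
Qed.

End DecidePolytime.

(** * Reading the input word *)

(** A one-hot code, all false for [Hash], so that case analysis on symbols becomes nested tests of
    components. *)
Definition symbol_tests (s : symbol) : bool * (bool * (bool * (bool * (bool * bool))))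
    :=
  (if s is Zero then true else false, (if s is One then true else false,
  (if s is Plus then true else false, (if s is Minus then true else false,
  (if s is Colon then true else false, if s is Semi then true else false))))).

Canonical symbol_data := @Data symbol (fun s => code (symbol_tests s)).

Lemma polytime_symbol_case (T U : data) (s : T -> symbol)
    (f0 f1 f2 f3 f4 f5 f6 : T -> U) :
  polytime s -> polytime f0 -> polytime f1 -> polytime f2 -> polytime f3 ->
  polytime f4 -> polytime f5 -> polytime f6 ->
  polytime (fun x => match s x with
    | Zero => f0 x | One => f1 x | Plus => f2 x | Minus => f3 x
    | Colon => f4 x | Semi => f5 x | Hash => f6 x end).
Proof.
move=> Ps P0 P1 P2 P3 P4 P5 P6.
have Pt : polytime (fun x => symbol_tests (s x)) by exact: Ps.
suff -> : (fun x => match s x with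
    | Zero => f0 x | One => f1 x | Plus => f2 x | Minus => f3 x
    | Colon => f4 x | Semi => f5 x | Hash => f6 x end) =
  (fun x => let t := symbol_tests (s x) in if t.1 then f0 x else if t.2.1 then f1 x else
    if t.2.2.1 then f2 x else if t.2.2.2.1 then f3 x else if t.2.2.2.2.1 then f4 x else
    if t.2.2.2.2.2 then f5 x else f6 x).
  by do 6 (apply: polytime_if => //; first by polytime_tac).
by apply/funext => x; case: (s x).
Qed.

(* Literals and rules as they are read: variables are words of bits. *)
Definition raw_literal : Type := (bool * seq bool)%type.
Definition raw_rule : Type := (seq raw_literal * raw_literal)%type.

(* The word is read from right to left. A state consists of the bits of the
   variable being read, the literals read since the last separator, those
   between the last [Colon] and the [Semi] that follows it, the rules, and the
   sections ended by a [Hash]. *)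
Definition parser_state : Type :=
  (seq bool * (seq raw_literal * (seq raw_literal *
      (seq raw_rule * seq (seq raw_literal)))))%type.

(** From right to left, a rule is complete only at the [Semi] of the rule before it or at the
    beginning of the word; an empty [concl] means that no rule is pending. *)
Definition end_rule (lits concl : seq raw_literal) (hs : seq raw_rule) : seq raw_rule :=
  if concl is l :: _ then (lits, l) :: hs else hs.

Definition parse_symbol (s : symbol) (z : parser_state) : parser_state :=
  match s with
  | Zero => (false :: z.1, z.2)
  | One => (true :: z.1, z.2)
  | Plus => ([::], ((true, z.1) :: z.2.1, z.2.2))
  | Minus => ([::], ((false, z.1) :: z.2.1, z.2.2))
  | Colon => (z.1, ([::], (z.2.1, z.2.2.2)))
  | Semi => (z.1, ([::], ([::], (end_rule z.2.1 z.2.2.1 z.2.2.2.1, z.2.2.2.2))))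
  | Hash => (z.1, ([::], (z.2.2.1, (z.2.2.2.1, z.2.1 :: z.2.2.2.2))))
  end.

Definition parse_word (w : seq symbol) :
    seq raw_rule * (seq raw_literal * seq raw_literal) :=
  let z := foldr parse_symbol ([::], ([::], ([::], ([::], [::])))) w in
  (end_rule z.2.1 z.2.2.1 z.2.2.2.1,
   (head [::] z.2.2.2.2, head [::] (behead z.2.2.2.2))).

(** * The parser runs in polynomial time *)

Section ParsePolytime.

Let raw_literalD := prod_data bool_data (seq_data bool_data).
Let raw_ruleD := prod_data (seq_data raw_literalD) raw_literalD.
Let stateD := prod_data (seq_data bool_data) (prod_data (seq_data raw_literalD)
  (prod_data (seq_data raw_literalD)
      (prod_data (seq_data raw_ruleD) (seq_data (seq_data raw_literalD))))).

Lemma polytime_end_rule (T : data) (lits concl : T -> seq raw_literalD)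
    (hs : T -> seq raw_ruleD) :
  polytime lits -> polytime concl -> polytime hs ->
  polytime ((fun x => end_rule (lits x) (concl x) (hs x)) : T -> seq raw_ruleD).
Proof.
move=> Pl Pc Ph; apply: (polytime_case (g := fun x l _ => (lits x, l) :: hs x)) => //.
apply: polytime_cons; [apply: polytime_pair|]; last by apply: polytime_comp Ph;
    polytime_tac.
  by apply: polytime_comp Pl; polytime_tac.
by polytime_tac.
Qed.

Lemma len_end_rule (lits concl : seq raw_literalD) (hs : seq raw_ruleD) :
  len (end_rule lits concl hs : seq raw_ruleD) <= (len lits + len concl + len hs).+1.
Proof.
case: concl => [|l c] /=; first by lia.
by rewrite (@len_cons raw_ruleD) (@len_pair (seq_data raw_literalD))
    (@len_cons raw_literalD); lia.
Qed.

Lemma polytime_parse_symbol :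
  polytime ((fun z => parse_symbol z.1 z.2) : symbol_data * stateD -> stateD).
Proof.
apply: polytime_symbol_case; try by polytime_tac.
apply: polytime_pair; first by polytime_tac.
apply: polytime_pair; first by polytime_tac.
apply: polytime_pair; first by polytime_tac.
by apply: polytime_pair; [apply: polytime_end_rule|]; polytime_tac.
Qed.

Lemma len_parse_symbol (s : symbol) (z : stateD) : len (parse_symbol s z : stateD) <=
    len z + 6.
Proof.
have len_state (y : stateD) :
    len y = len y.1 + len y.2.1 + len y.2.2.1 + len y.2.2.2.1 + len y.2.2.2.2 + 4.
  by case: y => b [l [c [h o]]]; rewrite !len_pair /=; lia.
rewrite !len_state; case: z => b [l [c [h o]]]; rewrite /parse_symbol.
have end_rule_le := len_end_rule l c h.
case: s; rewrite /= ?(@len_cons bool_data) ?(@len_cons (seq_data raw_literalD))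
  ?(@len_cons raw_literalD) ?(@len_pair bool_data) ?len_bool ?len_nil /=; lia.
Qed.

(** Loading the input reverses it, and on the reversed word the right-to-left parse is a left
    fold. *)
Lemma polytime_parse_rev :
  polytime ((fun w => parse_word (rev w)) : seq symbol_data -> 
   prod_data (seq_data raw_ruleD) (prod_data (seq_data raw_literalD)
       (seq_data raw_literalD))).
Proof.
pose z0 : stateD := ([::], ([::], ([::], ([::], [::])))).
pose final (w : seq symbol_data) : stateD := foldl (fun z s => parse_symbol s z) z0 w.
suff Pf : polytime final.
  rewrite (_ : (fun w => _) = (fun w => let z := final w in
    (end_rule z.2.1 z.2.2.1 z.2.2.2.1,
        (head [::] z.2.2.2.2, head [::] (behead z.2.2.2.2))))).
    apply: polytime_pair; last by polytime_tac.
    by apply: polytime_end_rule; polytime_tac.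
  by apply/funext => w; rewrite /parse_word /final -foldl_rev revK.
apply: (@polytime_foldl 5 (seq_data symbol_data) symbol_data stateD id (fun=> z0)
    (fun _ s z => parse_symbol s z)).
- move=> x s z; apply: leq_trans (len_parse_symbol _ _) _; rewrite leq_add2l.
  have : 2 ^ 5 <= (len x + len s + 2) ^ 5 by apply: leq_exp_l; lia.
  by apply: leq_trans.
- exact: polytime_id.
- exact: polytime_const.
- by apply: polytime_comp polytime_parse_symbol; polytime_tac.
Qed.

End ParsePolytime.

(** * Correctness of the parser *)

Definition raw (l : literal) : raw_literal := (l.1, bits l.2).
Definition raw_of_default (h : horn_default) : raw_rule :=
  ([seq (true, bits p) | p <- h.1], raw h.2).

Lemma parse_cons s w z :
  foldr parse_symbol z (s :: w) = parse_symbol s (foldr parse_symbol z w).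
Proof. by []. Qed.

Lemma parse_nat n b (z : seq raw_literal *
    (seq raw_literal * (seq raw_rule * seq (seq raw_literal)))) :
  foldr parse_symbol (b, z) (encode_nat n) = (bits n ++ b, z).
Proof.
rewrite /bits /encode_nat; case: (bin_of_nat n) => //= p.
by elim: p => //= p ->.
Qed.

Lemma parse_literal l ls z :
  foldr parse_symbol ([::], (ls, z)) (encode_literal l) = ([::], (raw l :: ls, z)).
Proof. by case: l => -[] n; rewrite /encode_literal /= parse_nat cats0. Qed.

Lemma parse_literals ls ls' z :
  foldr parse_symbol ([::], (ls', z)) (flatten (map encode_literal ls)) =
  ([::], (map raw ls ++ ls', z)).
Proof.
elim: ls => [//|l ls IH].
by rewrite -[flatten _]/(encode_literal l ++ flatten (map encode_literal ls)) foldr_cat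
    IH parse_literal.
Qed.

(** Reading a default completes the one to its right and leaves the default itself pending. *)
Lemma parse_default h ls c hs o :
  foldr parse_symbol ([::], (ls, (c, (hs, o)))) (encode_default h) =
  ([::], ([seq (true, bits p) | p <- h.1], ([:: raw h.2], (end_rule ls c hs, o)))).
Proof.
rewrite /encode_default foldr_cat.
rewrite parse_cons foldr_rcons [parse_symbol Semi _]/= parse_literal
    [parse_symbol Colon _]/=.
by rewrite (map_comp encode_literal (pair true)) parse_literals cats0 -map_comp.
Qed.

Lemma parse_encode hs ws c :
  parse_word (encode hs ws c) = (map raw_of_default hs, (map raw ws, map raw c)).
Proof.
rewrite /parse_word /encode !foldr_cat.
rewrite parse_cons foldr_cat parse_cons.
rewrite parse_literals [parse_symbol Hash (_, (_ ++ _, _))]/= parse_literals !cats0.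
rewrite [parse_symbol Hash _]/=.
(* The invariant counts the pending rule as already added by [end_rule], which is what the induction
   on [hs] preserves. *)
set z0 := ([::], _); suff : let z := foldr parse_symbol z0
    (flatten (map encode_default hs)) in
  [/\ z.1 = [::], end_rule z.2.1 z.2.2.1 z.2.2.2.1 = map raw_of_default hs &
     z.2.2.2.2 = [:: map raw ws; map raw c]] by case=> _ -> ->.
elim: hs => [//|h hs]; rewrite -[flatten (map _ (_ :: _))]/(encode_default h ++ flatten
    (map encode_default hs)) foldr_cat /=; case: (foldr _ _ _) => b [l [c' [h' o]]] /=
    [-> <- ->].
by rewrite parse_default.
Qed.

Definition rule_of_default (h : horn_default) : rule :=
    ([seq (true, p) | p <- h.1], h.2).

Lemma code_map (T U : data) (f : T -> U) s :
  (forall x, code (f x) = code x) -> code (map f s) = code s.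
Proof. by move=> fE; elim: s => //= x s IH; rewrite fE; congr Node. Qed.

(* A variable and its bits have the same code, hence the parser in effect
   outputs the theory itself. *)
Lemma code_parse_encode hs ws c :
  code (parse_word (encode hs ws c)) = code
      (map rule_of_default hs, (ws, c) : seq (bool*nat) * seq (bool*nat)).
Proof.
have code_raws (ls : seq (bool * nat)) :
    code (map raw ls : seq (bool * seq bool)) = code ls by apply: code_map.
rewrite parse_encode; congr Node; last by congr Node; apply: code_raws.
rewrite (_ : map raw_of_default hs =
  [seq (map raw h.1, raw h.2) | h <- map rule_of_default hs]); last first.
  by rewrite -map_comp; apply: eq_map => h; rewrite /raw_of_default /= -map_comp.
apply: (@code_map (prod_data (seq_data (prod_data bool_data nat_data))
    (prod_data bool_data nat_data))) => h.
by congr Node; apply: code_raws.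
Qed.

(** * Sets of literals that generate extensions *)

Lemma negK : involutive neg.
Proof. by case=> b n; rewrite /neg /= negbK. Qed.

Lemma consistentP (L : seq literal) :
  reflect (forall l, l \in L -> neg l \notin L) (consistent L).
Proof. exact: allP. Qed.

Lemma mem_known W A l : (l \in known W A) = (l \in W) || (l \in map snd A).
Proof.
rewrite /known; elim: A W => [|h A IH] W /=; first by rewrite orbF.
by rewrite IH !inE [RHS]orbCA orbA.
Qed.

Section Extensions.

Variables (D : seq rule) (W : seq literal).

(** Finite derivations from the facts stand for the minimality in [Gamma]. *)
Inductive derived (X : seq literal) : literal -> Prop :=
| Derived_fact l of l \in W : derived X l
| Derived_rule h of h \in D & (forall l, l \in h.1 -> derived X l) & h.2 \in X :
    derived X h.2.

Lemma derived_sub X Y l : {subset X <= Y} -> derived X l -> derived Y l.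
Proof.
move=> XY; elim=> {l} [l|h hD _ IH hX]; first exact: Derived_fact.
by apply: Derived_rule => //; apply: XY.
Qed.

Definition grounded (L : seq literal) : Prop :=
  [/\ {subset W <= L}, consistent L & forall l, l \in L -> derived L l].

Definition applied (L : seq literal) (h : rule) : bool :=
  all (fun l => l \in L) h.1 && (neg h.2 \notin L).

(* The sets of literals that generate the extensions. *)
Definition literal_extension (L : seq literal) : Prop :=
  grounded L /\ forall h, h \in D -> applied L h -> h.2 \in L.

(** The decreasing measure, both for extending a grounded set and for the passes of the closure. *)
Lemma count_missing (S S' : seq literal) h :
  {subset S <= S'} -> h \in D -> h.2 \notin S -> h.2 \in S' ->
  count (fun h : rule => h.2 \notin S') D < count (fun h : rule => h.2 \notin S) D.
Proof.
move=> SS'; elim: D => //= h1 D1 IH; rewrite inE => /orP[/eqP <-|hD1] hS hS'.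
  rewrite hS hS' add0n add1n ltnS; apply: sub_count => h2 /=; exact/contra/SS'.
rewrite -addnS leq_add ?IH //.
by case: (boolP (h1.2 \in S)) => [/SS' ->|_]; last exact: leq_b1.
Qed.

(** The only justification of a rule is its conclusion, so adding the conclusion of an applied rule
    keeps the set consistent and grounded; this is repeated until no conclusion is missing. *)
Lemma grounded_extends (L : seq literal) :
  grounded L -> exists2 L', {subset L <= L'} & literal_extension L'.
Proof.
have [n] := ubnP (count (fun h : rule => h.2 \notin L) D).
elim: n L => // n IH L /ltnSE len gL.
case: (boolP (has (fun h => applied L h && (h.2 \notin L)) D)) =>
    [/hasP[h hD /andP[hL h2]]|].
  case: gL => [WL /consistentP cL dL]; case/andP: hL => /allP h1 nh2.
  have LL' : {subset L <= h.2 :: L} by move=> l lL; rewrite inE lL orbT.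
  have [||L' L'_sub L'ext] := IH (h.2 :: L).
  - by apply: leq_trans len; apply: count_missing hD h2 _ => //; rewrite mem_head.
  - split; first by move=> l /WL/LL'.
      apply/consistentP => l; rewrite !inE !negb_or => /orP[/eqP ->|lL].
        by rewrite nh2 andbT; apply/eqP => /(congr1 fst) /=; case: (h.2.1).
      rewrite cL // andbT; apply: contra nh2 => /eqP <-; by rewrite negK.
    move=> l; rewrite inE => /orP[/eqP ->|/dL]; last exact: derived_sub.
    apply: Derived_rule => //; last exact: mem_head.
    by move=> l1 /h1/dL; apply: derived_sub.
  - by exists L' => // l /LL'/L'_sub.
move=> /hasPn clL; exists L => //; split=> // h /clL; rewrite negb_and negbK.
by case/orP=> // /negPf ->.
Qed.

Lemma closure_pass_mono B S : {subset S <= closure_pass D B S}.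
Proof.
rewrite /closure_pass; elim: D S => [|h D1 IH] S l lS //=.
by apply: IH; case: ifP => // _; rewrite inE lS orbT.
Qed.

Lemma closure_pass_ind (Q : literal -> Prop) B S :
  (forall h, h \in D -> h.2.1 -> neg h.2 \notin B -> (forall l, l \in h.1 -> Q l) -> Q
      h.2) ->
  (forall l, l \in S -> Q l) -> forall l, l \in closure_pass D B S -> Q l.
Proof.
rewrite /closure_pass => QD; have {QD} : forall h, h \in D -> h.2.1 ->
  neg h.2 \notin B -> (forall l, l \in h.1 -> Q l) -> Q h.2 by [].
elim: D S => //= h D1 IH S QD QS; apply: IH => [h' h'D|].
  by apply: QD; rewrite inE h'D orbT.
case: ifP => // /and3P[h21 nh2 /allP h1] l; rewrite inE => /orP[/eqP ->|/QS //].
by apply: QD => //; [rewrite mem_head | move=> l1 /h1/QS].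
Qed.

Lemma rule_closure_ind (Q : literal -> Prop) B :
  (forall h, h \in D -> h.2.1 -> neg h.2 \notin B -> (forall l, l \in h.1 -> Q l) -> Q
      h.2) ->
  (forall l, l \in W -> Q l) -> forall l, l \in rule_closure D B W -> Q l.
Proof.
rewrite /rule_closure => QD; elim: {2}D W => //= h D1 IH S QS; apply: IH.
exact: closure_pass_ind.
Qed.

Lemma rule_closure_sub B : {subset W <= rule_closure D B W}.
Proof.
rewrite /rule_closure; elim: {2}D W => [|h D1 IH] S l lS //=.
by apply: IH; apply: closure_pass_mono.
Qed.

Let closed B S := all (fun h => fires B S h ==> (h.2 \in S)) D.

Lemma fires_sub B S S' h : {subset S <= S'} -> fires B S h -> fires B S' h.
Proof.
by move=> SS' /and3P[h21 nh2 h1]; apply/and3P; split=> //; apply: sub_all h1 => l /SS'.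
Qed.

Lemma closure_pass_closed B S : closed B S -> closure_pass D B S =i S.
Proof.
move=> /allP clS; rewrite /closure_pass.
suff pass D1 S' : {subset D1 <= D} -> S' =i S ->
    foldl (fun S h => if fires B S h then h.2 :: S else S) S' D1 =i S by exact: pass.
elim: D1 S' => //= h D1 IH S' D1D S'S.
apply: IH => [h' h'D|l]; first by apply: D1D; rewrite inE h'D orbT.
case: ifP => // fh; rewrite inE S'S; apply/orb_idl => /eqP ->.
apply: (implyP (clS h _)); first by apply: D1D; rewrite mem_head.
by apply: fires_sub fh => x; rewrite S'S.
Qed.

(** A rule that fires at the start of a pass still fires at its turn, since firing is monotone in
    [S]. *)
Lemma closure_pass_progress B S : ~~ closed B S ->
  count (fun h : rule => h.2 \notin closure_pass D B S) D < count
      (fun h : rule => h.2 \notin S) D.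
Proof.
rewrite -has_predC => /hasP[h hD]; rewrite /= negb_imply => /andP[fh h2].
apply: (count_missing _ hD h2); first exact: closure_pass_mono.
rewrite /closure_pass; move: fh hD; elim: D S {h2} => //= h' D1 IH S fh.
have mono T : {subset T <= foldl (fun S h => if fires B S h then h.2 :: S else S) T D1}.
  elim: {IH} D1 T => [|h1 D1 IH] T l lT //=; apply: IH; case: ifP => // _.
  by rewrite inE lT orbT.
rewrite inE => /orP[/eqP <-|]; first by rewrite fh; apply: mono; apply: mem_head.
by apply: IH; case: ifP => // _; apply: fires_sub fh => l lS; rewrite inE lS orbT.
Qed.

(** Each pass before the fixpoint lowers the number of rules with a missing conclusion, which is at
    most the number of passes. *)
Lemma rule_closure_closed B h : h \in D -> fires B (rule_closure D B W) h -> h.2 \in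
    rule_closure D B W.
Proof.
move=> hD; suff /allP/(_ h hD)/implyP : closed B (rule_closure D B W) by [].
rewrite /rule_closure.
suff : forall D1 S, count (fun h : rule => h.2 \notin S) D <= size D1 ->
    closed B (foldl (fun S (_ : rule) => closure_pass D B S) S D1) by apply; apply:
        count_size.
have clE S S' : S =i S' -> closed B S -> closed B S'.
  move=> SS' /allP clS; apply/allP => h' /clS; rewrite SS'; congr (_ ==> _).
  by congr [&& _, _ & _]; apply: eq_all => l; rewrite SS'.
elim=> [|h1 D1 IH] S /=; last first.
  move=> le_S; case: (boolP (closed B S)) => [clS|/closure_pass_progress lt_S]; last
      first.
    by apply: IH; rewrite -ltnS (leq_trans lt_S).
  have {le_S} : closed B (closure_pass D B S).
    by apply: (clE S _ _ clS) => l; rewrite closure_pass_closed.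
  elim: {IH} D1 (closure_pass D B S) => //= _ D1 IH S1 clS1; apply: IH.
  by apply: (clE S1 _ _ clS1) => l; rewrite closure_pass_closed.
rewrite leqn0 => /eqP c0; apply/allP => h' h'D; apply/implyP => _.
case: (boolP (h'.2 \in S)) => // h'S.
have : has (fun h : rule => h.2 \notin S) D by apply/hasP; exists h'.
by rewrite has_count c0.
Qed.

End Extensions.

Lemma mem_split (T : eqType) (x : T) s : x \in s -> exists s1 s2, s = s1 ++ x :: s2.
Proof. by case/splitPr => s1 s2; exists s1, s2. Qed.

(** * Feasible sets of rules and the greedy choice *)

Section Greedy.

Variables (D : seq rule) (W : seq literal).

Lemma literal_extension_mem L h :
  literal_extension D W L -> h \in D -> applied L h -> h.2 \in L.
Proof. by case=> _; apply. Qed.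

(** The closure together with the conclusions of [A] is grounded, hence lies in some extension; as
    this is consistent and contains the conclusions, no rule of [A] is blocked there. *)
Lemma feasible_extension A :
  {subset A <= D} -> feasible D W A ->
  exists2 L, literal_extension D W L & all (applied L) A.
Proof.
move=> AD /andP[/consistentP cB /allP preA].
set B := known W A in cB preA; set S := rule_closure D B W in preA.
pose S0 := S ++ map snd A.
have WB l : l \in W -> l \in B by rewrite mem_known => ->.
have AB l : l \in map snd A -> l \in B by rewrite mem_known orbC => ->.
have S_cases l : l \in S -> (l \in W) || (l.1 && (neg l \notin B)).
  move: l; apply: (rule_closure_ind
      (Q := fun l => (l \in W) || (l.1 && (neg l \notin B)))).
    by move=> h _ -> -> _; rewrite orbT.
  by move=> l ->.
have gS0 : grounded D W S0.
  split.
  - by move=> l lW; rewrite mem_cat (rule_closure_sub D B lW).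
  - apply/consistentP => l; have notS l1 : l1 \in S -> l1 \in B \/ l1.1 /\ neg l1
      \notin B.
      by move/S_cases/orP => [/WB|/andP]; [left|right].
    have notB l1 : l1 \in S0 -> l1 \in B \/ l1.1 /\ neg l1 \notin B.
      by rewrite mem_cat => /orP[/notS //|/AB]; left.
    move=> /notB lS0; apply/negP => /notB nlS0; move: lS0 nlS0; rewrite negK.
    (* Two members of [B] do not clash as [B] is consistent, a member of [B] and an unblocked
       literal by the guard of [fires], and two unblocked literals because both are positive. *)
    case=> [lB|[l1 nlB]] [nlB'|[nl1 lB']].
    + by move: (cB _ lB); rewrite nlB'.
    + by rewrite lB in lB'.
    + by rewrite nlB' in nlB.
    + by move: nl1; rewrite /= l1.
  have dS l : l \in S -> derived D W S0 l.
    move=> lS; suff [] : derived D W S0 l /\ l \in S by [].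
    move: l lS; apply: (rule_closure_ind (Q := fun l => derived D W S0 l /\ l \in S));
        last first.
      by move=> l lW; split; [exact: Derived_fact | exact: rule_closure_sub].
    move=> h hD h21 nh2 h1.
    have h2S : h.2 \in S.
      apply: rule_closure_closed => //; apply/and3P; split=> //.
      by apply/allP => l /h1[].
    split=> //; apply: Derived_rule => //; last by rewrite mem_cat h2S.
    by move=> l /h1[].
  move=> l; rewrite mem_cat => /orP[/dS //|/mapP[h hA ->]].
  apply: Derived_rule; first exact: AD.
    by move=> l1 l1h; apply: dS; apply: (allP (preA h hA)).
  by rewrite mem_cat map_f ?orbT.
have [L S0L Lext] := grounded_extends gS0; exists L => //.
have [[_ /consistentP cL _] _] := Lext.
apply/allP => h hA; apply/andP; split.
  by apply/allP => l lh; apply: S0L; rewrite mem_cat (allP (preA h hA) l lh).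
by apply: cL; apply: S0L; rewrite mem_cat map_f ?orbT.
Qed.

(* A negative conclusion is then useless to derive another rule's premises,
   hence the closure may ignore it. *)
Hypothesis positive : forall h l, h \in D -> l \in h.1 -> l.1.

(** A positive literal of [L] has a derivation in which all conclusions are positive, because
    premises are. As [known W A] lies in the consistent set [L], it blocks none of these steps, so
    the closure reaches every premise of [A]. *)
Lemma extension_feasible L A :
  literal_extension D W L -> {subset A <= D} -> all (applied L) A -> feasible D W A.
Proof.
move=> Lext AD /allP apA; have [[WL /consistentP cL dL] _] := Lext.
have BL : {subset known W A <= L}.
  move=> l; rewrite mem_known => /orP[/WL //|/mapP[h hA ->]].
  by apply: (literal_extension_mem Lext); [apply: AD | apply: apA].
apply/andP; split.
  apply/consistentP => l /BL/cL; apply: contra; exact: BL.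
have LS l : derived D W L l -> l.1 -> l \in rule_closure D (known W A) W.
  elim=> {l} [l lW _|h hD _ IH hL h21]; first exact: rule_closure_sub.
  apply: rule_closure_closed => //; apply/and3P; split=> //.
    by apply: contra (cL _ hL) => /BL.
  by apply/allP => l lh; apply: IH => //; apply: positive lh.
apply/allP => h hA; apply/allP => l lh; apply: LS; last exact: (positive (AD _ hA) lh).
by apply: dL; case/andP: (apA _ hA) => /allP/(_ l lh).
Qed.

(** The intermediate states of the greedy choice: [D1] varies, while feasibility still refers to all
    of [D]. *)
Definition greedy_from (A D1 : seq rule) : seq rule :=
  foldl (fun A h => if feasible D W (h :: A) then h :: A else A) A D1.

Lemma greedy_from_mono A D1 : {subset A <= greedy_from A D1}.
Proof.
elim: D1 A => [|h D1 IH] A h' hA //=; apply: IH.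
by case: ifP => // _; rewrite inE hA orbT.
Qed.

Lemma greedy_from_sub A D1 h : h \in greedy_from A D1 -> (h \in A) || (h \in D1).
Proof.
elim: D1 A => [|h1 D1 IH] A /=; first by rewrite orbF.
by move=> /IH; case: ifP; rewrite !inE => _; case: (h == h1); case: (h \in A).
Qed.

Lemma greedy_cat D1 D2 : D = D1 ++ D2 ->
  greedy D W = greedy_from (greedy_from [::] D1) D2.
Proof.
by move=> DE; rewrite /greedy_from -foldl_cat -DE.
Qed.

Lemma greedy_feasible : consistent W -> feasible D W (greedy D W).
Proof.
move=> cW; rewrite -[greedy D W]/(greedy_from [::] D).
suff pres D1 A : feasible D W A -> feasible D W (greedy_from A D1).
  by apply: pres; rewrite /feasible /known /= cW.
by elim: D1 A => //= h D1 IH A fA; apply: IH; case: ifP.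
Qed.

Lemma greedy_sub : {subset greedy D W <= D}.
Proof. by move=> h /(@greedy_from_sub [::]). Qed.

Definition generated_by_greedy (L : seq literal) : Prop :=
  forall h, h \in D -> applied L h = (h \in greedy D W).

Lemma greedy_maximal L h D1 D2 :
  D = D1 ++ h :: D2 -> literal_extension D W L ->
  all (applied L) (greedy_from [::] D1) -> applied L h -> h \in greedy D W.
Proof.
move=> DE Lext apA aph.
rewrite (greedy_cat DE) /=; rewrite (@extension_feasible L).
- by apply: greedy_from_mono; rewrite mem_head.
- exact: Lext.
- move=> h'; rewrite inE DE => /orP[/eqP ->|/greedy_from_sub /= h'D1].
    by rewrite mem_cat mem_head orbT.
  by rewrite mem_cat h'D1.
- by rewrite /= aph.
Qed.

Lemma greedy_prefix D1 D2 : D = D1 ++ D2 -> {subset greedy_from [::] D1 <= greedy D W}.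
Proof. by move=> DE h; rewrite (greedy_cat DE); apply: greedy_from_mono. Qed.

(** The kept rules are feasible, so some extension applies them all; by maximality it applies no
    other rule of [D]. *)
Lemma greedy_extension : consistent W ->
  exists2 L, literal_extension D W L & generated_by_greedy L.
Proof.
move=> cW; have [L Lext apL] := feasible_extension greedy_sub (greedy_feasible cW).
exists L => // h hD; apply/idP/idP => [aph|]; last by move/(allP apL).
have [D1 [D2 DE]] := mem_split hD.
apply: (greedy_maximal DE Lext _ aph); apply/allP => h' h'A.
exact/(allP apL)/(greedy_prefix DE).
Qed.

(** If [L'] applied all rules kept before [h], then [h] would be kept too; so [L'] misses one of
    them, and this rule has higher priority. *)
Lemma greedy_witness L L' h D1 D2 :
  generated_by_greedy L -> literal_extension D W L' -> D = D1 ++ h :: D2 ->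
  applied L' h -> ~~ applied L h ->
  exists e, [/\ e \in D1, applied L e & ~~ applied L' e].
Proof.
move=> Lgr L'ext DE aph naph.
have hD : h \in D by rewrite DE mem_cat mem_head orbT.
case: (boolP (all (applied L') (greedy_from [::] D1))) => [apA|].
  by move: naph; rewrite Lgr // (greedy_maximal DE L'ext apA aph).
case/allPn => e eA nape; have eD1 : e \in D1 by have := greedy_from_sub eA.
exists e; split=> //; rewrite Lgr ?(greedy_prefix DE) //.
by rewrite DE mem_cat eD1.
Qed.

(** Induction on prefixes of [D]. If [h] is feasible with the rules kept so far but [L] does not
    apply it, some [L'] applies them all. Preference gives an earlier [e] applied in [L] and not in
    [L']; but [e] was kept by induction, so [L'] applies it. *)
Lemma preferred_greedy (T : rule -> rule -> Prop) L :
  literal_extension D W L ->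
  (forall h e D1 D2, D = D1 ++ h :: D2 -> e \in D -> T e h -> e \in D1) ->
  (forall L' h, literal_extension D W L' -> h \in D -> applied L' h -> ~~ applied L h ->
     exists e, [/\ e \in D, T e h, applied L e & ~~ applied L' e]) ->
  generated_by_greedy L.
Proof.
move=> Lext T_D prefL.
suff prefix D1 D2 : D = D1 ++ D2 -> forall e, e \in D1 -> applied L e =
    (e \in greedy_from [::] D1).
  by move=> h hD; apply: (prefix D [::]) => //; rewrite cats0.
elim/last_ind: D1 D2 => // D1 h IH D2; rewrite cat_rcons => DE e.
have {}IH := IH _ DE.
have sub_D x : x \in h :: greedy_from [::] D1 -> x \in D.
  rewrite inE DE mem_cat inE => /orP[/eqP ->|/greedy_from_sub /= ->] //.
  by rewrite eqxx orbT.
have apA : all (applied L) (greedy_from [::] D1).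
  by apply/allP => x xA; rewrite IH //; have := greedy_from_sub xA.
have hE : applied L h = feasible D W (h :: greedy_from [::] D1).
  apply/idP/idP => [aph|fh]; first by apply: extension_feasible Lext sub_D _; rewrite
      /= aph.
  have [L' L'ext /= /andP[aph' /allP apA']] := feasible_extension sub_D fh.
  apply: contraT => naph.
  have [e' [e'D Te' ape' /negP[]]] := prefL L' h L'ext (sub_D _ (mem_head _ _)) aph'
      naph.
  by apply: apA'; rewrite -IH // (T_D _ _ _ _ DE e'D Te').
rewrite /greedy_from foldl_rcons -/(greedy_from [::] D1) -hE mem_rcons inE.
case: (eqVneq e h) => [-> _ | neh /= eD1].
  case: ifP => [_|nh]; first by rewrite mem_head.
  by symmetry; apply: contraFF nh => /(allP apA).
by rewrite IH //; case: ifP => // _; rewrite inE (negPf neh).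
Qed.

(** A literal of [L] that is not a fact concludes a rule with premises in [L]; by consistency this
    rule is applied, hence kept. *)
Lemma generated_by_greedy_mem L :
  literal_extension D W L -> generated_by_greedy L -> L =i known W (greedy D W).
Proof.
move=> Lext Lgr l; have [[WL /consistentP cL dL] _] := Lext.
rewrite mem_known; apply/idP/idP => [lL|/orP[/WL //|/mapP[h hA ->]]]; last first.
  by apply: (literal_extension_mem Lext) => //; [|rewrite Lgr //]; apply: greedy_sub.
have dl := dL _ lL; case: dl lL => [l0 ->|h hD dh _ hL] //.
rewrite (map_f snd) ?orbT // -Lgr //; apply/andP; split; last exact: cL.
apply/allP => l1 /dh; elim=> {l1} [l1 /WL //|h1 _ _ _ h1L].
exact: h1L.
Qed.

End Greedy.

(** * Extensions as sets of formulas *)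

Section Formulas.

Local Open Scope classical_set_scope.

Lemma eval_lit v l : eval v (lit_formula l) = (v l.2 == l.1).
Proof. by case: l => -[] x /=; case: (v x). Qed.

Lemma eval_not_lit v l : eval v (Not (lit_formula l)) = eval v (lit_formula (neg l)).
Proof. by rewrite eval_lit /= eval_lit /=; case: (v _); case: (l.1). Qed.

Lemma eval_clause v c : eval v (clause c) = has (fun l => v l.2 == l.1) c.
Proof. by elim: c => //= l c; rewrite /clause /= eval_lit => ->. Qed.

Lemma eval_prereq v h : eval v (prereq (horn_rule h)) = all (fun l => v l.2 == l.1)
    (rule_of_default h).1.
Proof. by case: h => ps l /=; elim: ps => //= p ps ->; rewrite eqb_id. Qed.

Lemma sub_Cn S : S `<=` Cn S.
Proof. by move=> f Sf v Sv; apply: Sv. Qed.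

Lemma Cn_sub S S' : S `<=` S' -> Cn S `<=` Cn S'.
Proof. by move=> SS' f Sf v S'v; apply: Sf => g /SS'/S'v. Qed.

Lemma CnK S : Cn (Cn S) = Cn S.
Proof.
apply/seteqP; split; last exact: sub_Cn.
by move=> f Sf v Sv; apply: Sf => g; apply.
Qed.

Lemma literals_eval L v : (forall g, literals_W L g -> eval v g) <->
  forall l, l \in L -> v l.2 == l.1.
Proof.
split=> [Lv l lL|Lv g [l lL <-]]; last by rewrite eval_lit; apply: Lv.
by rewrite -eval_lit; apply: Lv; exists l.
Qed.

Lemma Cn_clause L c : consistent L ->
  Cn (literals_W L) (clause c) <-> has (fun l => (l \in L) || (neg l \in c)) c.
Proof.
move=> /consistentP cL; split=> [Lc|/hasP[l lc lL] v /literals_eval Lv]; last first.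
  rewrite eval_clause; case/orP: lL => [/Lv vl|nlc]; first by apply/hasP; exists l.
  apply/hasP; have [vl|nvl] := boolP (v l.2 == l.1); first by exists l.
  by exists (neg l) => //=; move: nvl; case: (v _); case: (l.1).
(* A model of [L] that makes a variable left free by [L] true only if its negation occurs in [c]: a
   literal of [c] true in it is in [L] or has its complement in [c]. *)
pose v x := ((true, x) \in L) || ((false, x) \notin L) && ((false, x) \in c).
have Lv : forall l, l \in L -> v l.2 == l.1.
  move=> [[] x] lL; rewrite /v /=; first by rewrite lL.
  by rewrite lL orbF eqbF_neg; apply: cL (lL).
have /literals_eval/Lc := Lv; rewrite eval_clause => /hasP[[b x] lc /= vl].
apply/hasP; exists (b, x) => //; move: vl lc; rewrite /v /neg /=.
case: b; rewrite /= ?eqb_id ?eqbF_neg.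
  by case/orP=> [->|/andP[_ ->]]; rewrite ?orbT.
by rewrite negb_or negb_and negbK => /andP[_ /orP[->|/negPf ->]].
Qed.

Lemma Cn_literal L l : consistent L -> Cn (literals_W L) (lit_formula l) <-> l \in L.
Proof.
move=> cL; have := @Cn_clause L [:: l] cL; rewrite /= inE orbF.
have -> : (neg l == l) = false by apply/eqP => /(congr1 fst) /=; case: (l.1).
rewrite orbF => <-; split=> Ll v Lv; have := Ll v Lv; by rewrite /clause /= orbF.
Qed.

Lemma Cn_not_literal S l : Cn S (Not (lit_formula l)) <-> Cn S (lit_formula (neg l)).
Proof. by split=> Sl v Sv; have := Sl v Sv; rewrite eval_not_lit. Qed.

Lemma Cn_prereq S h : Cn S (prereq (horn_rule h)) <->
  forall l, l \in (rule_of_default h).1 -> Cn S (lit_formula l).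
Proof.
split=> [Sh l lh v Sv|Sh v Sv].
  by have := Sh v Sv; rewrite eval_prereq eval_lit => /allP; apply.
by rewrite eval_prereq; apply/allP => l lh; rewrite -eval_lit; apply: Sh.
Qed.

Lemma neg_justs_disjoint h S :
  neg_justs (horn_rule h) `&` S = set0 <-> ~ S (Not (lit_formula h.2)).
Proof.
split=> [E Sl|nSl].
  have : (neg_justs (horn_rule h) `&` S) (Not (lit_formula h.2)).
    by split=> //; rewrite /neg_justs /= inE.
  by rewrite E.
by apply/seteqP; split=> // f [] + Sf; rewrite /neg_justs /= inE => /eqP fE; rewrite fE
    in Sf.
Qed.

(** The bridge that carries preference from sets of formulas to sets of literals. *)
Lemma appl_Cn L h : consistent L ->
  appl (horn_rule h) (Cn (literals_W L)) <-> applied L (rule_of_default h).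
Proof.
move=> cL; rewrite /appl neg_justs_disjoint.
rewrite -[entails _ _]/(Cn (Cn (literals_W L)) (prereq (horn_rule h))).
rewrite !CnK Cn_prereq Cn_not_literal.
have CL l := @Cn_literal L l cL; rewrite CL.
split=> [[hL nL]|/andP[/allP hL /negP nL]].
  by apply/andP; split; [apply/allP => l /hL/CL | apply/negP].
by split=> // l /hL /CL.
Qed.

(** * Preferred extensions of a Horn default theory *)

Section HornTheory.

Variables (hs : seq horn_default) (ws : seq literal).

Let D := map rule_of_default hs.

Lemma Gamma_sub S G : literals_W ws `<=` G -> Cn G = G ->
  closed_under (horn_D hs) S G -> Gamma (horn_D hs) (literals_W ws) S `<=` G.
Proof. by move=> WG CG clG f; apply. Qed.

Lemma Gamma_facts S : literals_W ws `<=` Gamma (horn_D hs) (literals_W ws) S.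
Proof. by move=> f Wf G [_]; apply. Qed.

Lemma Gamma_Cn S f : Cn (Gamma (horn_D hs) (literals_W ws) S) f ->
  Gamma (horn_D hs) (literals_W ws) S f.
Proof.
move=> Gf G [[CG clG] WG]; rewrite -CG; apply: Cn_sub Gf.
by move=> g Gg; apply: Gg.
Qed.

Lemma Gamma_closed S :
  closed_under (horn_D hs) S (Gamma (horn_D hs) (literals_W ws) S).
Proof.
move=> d dD Gd nd G GP; have [[_ clG] _] := GP.
by apply: clG => //; apply: Gd.
Qed.

(** Minimality of [Gamma] gives one inclusion, induction on the derivations of the literals of [L]
    the other. *)
Lemma literal_extension_extension L :
  literal_extension D ws L -> extension (horn_D hs) (literals_W ws) (Cn (literals_W L)).
Proof.
move=> Lext; have [[WL cL dL] _] := Lext.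
apply/seteqP; split.
  apply: Gamma_sub.
  - by move=> f [l lW <-]; apply: sub_Cn; exists l => //; apply: WL.
  - exact: CnK.
  - move=> _ [h hhs <-] hL /neg_justs_disjoint nL.
    apply/Cn_literal => //; apply: (literal_extension_mem Lext (map_f _ hhs)).
    by apply/appl_Cn => //; split; [exact: (sub_Cn hL) | rewrite CnK;
        exact/neg_justs_disjoint].
move=> f Lf; apply: Gamma_Cn; apply: Cn_sub Lf => _ [l /dL dl <-].
elim: dl => {l} [l lW|_ /mapP[h hhs ->] _ IH hL]; first by apply: Gamma_facts; exists l.
apply: (@Gamma_closed _ (horn_rule h)); first by exists h.
  apply: Gamma_Cn; apply/Cn_prereq => l /IH; exact: sub_Cn.
apply/neg_justs_disjoint => /Cn_not_literal/(Cn_literal _ cL).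
by apply/negP; move/consistentP: cL; apply.
Qed.

(** The set [L] collects the literals derived by the rules that [E] does not block; minimality of
    [Gamma] shows that they generate [E]. *)
Lemma extension_literal_extension E :
  consistent ws -> extension (horn_D hs) (literals_W ws) E ->
  exists2 L, literal_extension D ws L & E = Cn (literals_W L).
Proof.
move=> cW Eext; have CE f : Cn E f -> E f by rewrite -{2}Eext -{1}Eext; apply: Gamma_Cn.
have clE : closed_under (horn_D hs) E E by rewrite -{2}Eext; apply: Gamma_closed.
have WE : literals_W ws `<=` E by rewrite -Eext; apply: Gamma_facts.
pose D0 := [seq h <- D | `[< ~ E (Not (lit_formula h.2)) >]].
pose L := [seq l <- ws ++ map snd D | `[< derived D0 ws (map snd D) l >]].
have LP l : l \in L <-> derived D0 ws (map snd D) l.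
  rewrite mem_filter; split=> [/andP[/asboolP]//|dl]; apply/andP; split; first
      exact/asboolP.
  rewrite mem_cat; case: dl => [l' -> //|h _ _ ->]; by rewrite orbT.
have LE l : l \in L -> E (lit_formula l).
  move/LP; elim=> {l} [l lW|h + _ IH _]; first by apply: WE; exists l.
  rewrite mem_filter => /andP[/asboolP nE /mapP[h' h'hs hE]]; rewrite hE in nE IH *.
  apply: (clE (horn_rule h')); first by exists h'.
    by apply: CE; apply/Cn_prereq => l /IH; apply: sub_Cn.
  exact/neg_justs_disjoint.
have ENot l : E (lit_formula (neg l)) -> E (Not (lit_formula l)).
  by move=> El; apply: CE; apply/Cn_not_literal; apply: sub_Cn.
have cL : consistent L.
  (* A rule concluding [l] is blocked once [E] contains [neg l], so a complementary pair in [L]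
     could only consist of facts. *)
  have fact l : l \in L -> neg l \in L -> l \in ws.
    move=> /LP dl nlL; case: dl nlL => // h + _ _ nhL.
    by rewrite mem_filter => /andP[/asboolP[]]; apply/ENot/LE.
  apply/consistentP => l lL; apply/negP => nlL.
  have /consistentP/(_ _ (fact _ lL nlL))/negP := cW; apply.
  by apply: fact => //; rewrite negK.
have EL : E = Cn (literals_W L).
  apply/seteqP; split; last by move=> f Lf; apply: CE; apply: Cn_sub Lf => _
      [l /LE El <-].
  rewrite -{1}Eext; apply: Gamma_sub.
  - by move=> _ [l lW <-]; apply: sub_Cn; exists l => //; apply/LP/Derived_fact.
  - exact: CnK.
  - move=> _ [h hhs <-] /Cn_prereq hL /neg_justs_disjoint nE.
    apply/Cn_literal => //; apply/LP.
    apply: (@Derived_rule _ _ _ (rule_of_default h)).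
    + by rewrite mem_filter map_f // andbT; apply/asboolP.
    + by move=> l /hL/(Cn_literal _ cL)/LP.
    + by rewrite map_f ?map_f.
exists L => //; split.
  split=> //; first by move=> l lW; apply/LP/Derived_fact.
  move=> l /LP; elim=> {l} [l|h hD dh IH hX]; first exact: Derived_fact.
  apply: Derived_rule => //; first by move: hD; rewrite mem_filter => /andP[].
  by apply/LP; apply: Derived_rule.
move=> h hD /andP[/allP hL nL]; apply/LP; apply: Derived_rule; last exact: map_f.
  rewrite mem_filter hD andbT; apply/asboolP; rewrite EL =>
      /Cn_not_literal/(Cn_literal _ cL).
  exact/negP.
by move=> l /hL/LP.
Qed.

Definition default_of_rule (h : rule) : horn_default := (map snd h.1, h.2).

Lemma rule_of_defaultK : cancel rule_of_default default_of_rule.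
Proof. by case=> ps l; rewrite /default_of_rule /= -map_comp map_id. Qed.

Variable P : default -> default -> Prop.

Hypothesis orderP : strict_total_order (horn_D hs) P.
Hypothesis sortedP : lists_by_priority P hs.

Lemma priority_cat hs1 h hs2 : hs = hs1 ++ h :: hs2 ->
  (forall e, e \in hs1 -> P (horn_rule e) (horn_rule h)) /\
  (forall e, e \in hs2 -> P (horn_rule h) (horn_rule e)).
Proof.
move=> hsE; move: sortedP; rewrite /lists_by_priority hsE pairwise_cat /=.
case/and3P=> /allrelP r12 _ /andP[/allP r2 _]; split=> e eh; apply/asboolP.
  by apply: r12; rewrite ?mem_head.
exact: r2.
Qed.

(** Any admissible [T] agrees with the listing [hs], so the greedy characterization applies. *)
Lemma preferred_literals E : consistent ws ->
  preferredL (horn_D hs) (literals_W ws) P E ->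
  exists L, [/\ consistent L, L =i known ws (greedy D ws) & E = Cn (literals_W L)].
Proof.
move=> cW [Eext [T [[[_ asymT] _] PT prefT]]].
have [L Lext EL] := extension_literal_extension cW Eext.
have [[_ cL _] _] := Lext; exists L; split=> //.
apply: generated_by_greedy_mem => //.
have positiveD (h : rule) l : h \in D -> l \in h.1 -> l.1.
  by case/mapP=> -[ps l'] _ -> /mapP[p _ ->].
pose T' (e h : rule) := T (horn_rule (default_of_rule e))
    (horn_rule (default_of_rule h)).
apply: (preferred_greedy positiveD (T := T')) => //
    [h e D1 D2 DE eD|L' h L'ext hD aph naph].
  have hsE : hs = map default_of_rule D1 ++ default_of_rule h :: map default_of_rule D2.
    by rewrite -[LHS](mapK rule_of_defaultK) -/D DE map_cat.
  have inD x : x \in D -> horn_D hs (horn_rule (default_of_rule x)).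
    by case/mapP=> x0 x0hs ->; rewrite rule_of_defaultK; exists x0.
  have hD : h \in D by rewrite DE mem_cat mem_head orbT.
  (* If [e] were [h], or were listed after it and so below it in [P], then [T] would hold both
     ways. *)
  rewrite /T' => Teh; have := eD; rewrite DE mem_cat inE => /or3P[//|/eqP eh|eD2].
    by case: (asymT _ _ (inD _ eD) (inD _ hD) Teh); rewrite -eh in Teh *.
  case: (asymT _ _ (inD _ eD) (inD _ hD) Teh); apply: PT; [exact: inD..|].
  by have [_] := priority_cat hsE; apply; apply: map_f.
have [h0 h0hs hE] := mapP hD; rewrite hE in aph naph *.
have [[_ cL' _] _] := L'ext.
have [||d [[e ehs <-] Te [ape nape]]] := prefT _ (horn_rule h0)
    (literal_extension_extension L'ext).
- by exists h0.
- by split; [exact/appl_Cn | rewrite EL => /(appl_Cn _ cL); apply/negP].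
exists (rule_of_default e); split; first exact: map_f.
- by rewrite /T' !rule_of_defaultK.
- by apply/appl_Cn => //; rewrite -EL.
- by apply/negP => /(appl_Cn _ cL').
Qed.

(** With [P] itself as [T], the greedy extension is preferred; this keeps entailment from being
    vacuous. *)
Lemma preferred_exists : consistent ws ->
  exists E, preferredL (horn_D hs) (literals_W ws) P E.
Proof.
move=> cW.
have positiveD (h : rule) l : h \in D -> l \in h.1 -> l.1.
  by case/mapP=> -[ps l'] _ -> /mapP[p _ ->].
have [L Lext Lgr] := greedy_extension positiveD cW.
have [[_ cL _] _] := Lext.
exists (Cn (literals_W L)); split; first exact: literal_extension_extension.
exists P; split=> // E' _ E'ext [h hhs <-].
have [L' L'ext ->] := extension_literal_extension cW E'ext.
have [[_ cL' _] _] := L'ext.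
case=> /(appl_Cn _ cL') aph naph.
have [hs1 [hs2 hsE]] := mem_split hhs.
have DE : D = map rule_of_default hs1 ++ rule_of_default h :: map rule_of_default hs2.
  by rewrite /D hsE map_cat.
have {}naph : ~~ applied L (rule_of_default h) by apply/negP => /(appl_Cn _ cL).
have [e [/mapP[e0 e0hs ->] ape nape]] := greedy_witness positiveD Lgr L'ext DE aph naph.
exists (horn_rule e0); split.
- by exists e0 => //; rewrite /= hsE mem_cat e0hs.
- by have [+ _] := priority_cat hsE; apply.
- by split; [exact/appl_Cn | move=> /(appl_Cn _ cL'); apply/negP].
Qed.

Lemma decide_correct c :
  entailsL (horn_D hs) (literals_W ws) P (Not (Not (clause c))) <-> decide (D, (ws, c)).
Proof.
have notnot S : Cn S (Not (Not (clause c))) <-> Cn S (clause c).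
  by split=> Sc v Sv; have := Sc v Sv; rewrite /= negbK.
rewrite /decide /=; case: (boolP (consistent ws)) => [cW|incW] /=; last first.
  split=> // _ E [Eext _]; rewrite -Eext; apply: Gamma_Cn => v Gv.
  case/allPn: incW => l lW; rewrite negbK => nlW.
  have Wv k : k \in ws -> eval v (lit_formula k).
    by move=> kW; apply: Gv; apply: Gamma_facts; exists k.
  by have := Wv _ lW; have := Wv _ nlW; rewrite -eval_not_lit /= => /negPf ->.
have key E : preferredL (horn_D hs) (literals_W ws) P E -> E (Not (Not (clause c))) <->
    has (fun l => (l \in known ws (greedy D ws)) || (neg l \in c)) c.
  case/(preferred_literals cW) => L [cL LE ->].
  rewrite notnot Cn_clause //; rewrite
      (@eq_has _ _ (fun l => (l \in known ws (greedy D ws)) || (neg l \in c))) //.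
  by move=> l; rewrite LE.
split=> [ent|dec E prefE]; last exact/key.
by have [E prefE] := preferred_exists cW; apply/(key E) => //; apply: ent.
Qed.

End HornTheory.

End Formulas.

(** * The machine *)

Definition load_symbol (a : symbol) : fragment 4 cell :=
  fseq (fpushes (token true :: word a)) (fpop tapeI).

Definition load_one (l : seq symbol) : fragment 4 cell :=
  foldr (fun a F => fif (is_top tapeI (inl a)) (load_symbol a) F) fskip l.

Definition symbols : seq symbol := [:: Zero; One; Plus; Minus; Colon; Semi; Hash].

(** The code of the empty list is pushed first and each symbol read is put in front, which yields
    the reversed word. *)
Definition load : fragment 4 cell :=
  fseq (fpush tapeM (token false)) (fwhile (is_nonempty tapeI) (load_one symbols)).

(** Five pair nodes and six Booleans, at most one of them true. *)
Lemma len_symbol_le (a : symbol) : len a <= 13.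
Proof. by case: a. Qed.

Lemma len_symbols_le (w : seq symbol) : len w <= 14 * size w + 1.
Proof.
elim: w => //= a w IH; rewrite (@len_cons symbol_data).
by have := len_symbol_le a; rewrite mulnS; lia.
Qed.

Lemma load_one_computes l (a : symbol) y m : a \in l ->
  computes (load_one l) (stacks4 (inl a :: y) m [::] [::])
    (stacks4 y ((token true :: word a) ++ m) [::] [::]) (size l + 30).
Proof.
elim: l => //= b l IH al; apply: fif_computes; rewrite /is_top ffunE /=.
have [E|nE] := eqVneq (Some (inl a) : option cell) (Some (inl b)).
  (* At most 14 tokens at two steps each, one step to end [fpushes] and one for the pop. *)
  case: E => <-; have le30 : (2 * size (token true :: word a) + 1) + 1 <= size l + 30.
    by have := len_symbol_le a; rewrite /len /=; lia.
  apply: computes_leq le30 _; apply: fseq_computes (@fpushes_computes _ _ _ _ _) _.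
  by case: (fpop4 (inl a :: y) ((token true :: word a) ++ m) [::] [::]).
apply: IH; move: al; rewrite inE => /orP[/eqP E|//].
by rewrite E eqxx in nE.
Qed.

Lemma load_computes (w : seq symbol) :
  computes load (stacks4 (map inl w) [::] [::] [::]) (on_main (word (rev w)))
    (2 + (40 * size w + 1)).
Proof.
apply: (@fseq_computes _ _ _ _ _ (stacks4 (map inl w) (word ([::] : seq symbol)) [::]
    [::])).
  by case: (fpush4 (map inl w) [::] [::] [::] (token false)).
rewrite /rev; elim: w [::] => [|a w IH] l /=.
  by apply: fwhile_computes_stop; rewrite /is_nonempty ffunE.
have -> : 40 * (size w).+1 + 1 = (39 + (40 * size w + 1)).+1 by rewrite mulnS; lia.
apply: fwhile_computes_loop (IH (a :: l)); first by rewrite /is_nonempty ffunE.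
rewrite (@word_cons symbol_data) -cat_cons.
have le39 : size symbols + 30 <= 39 by [].
apply: computes_leq le39 _; apply: load_one_computes.
by case: a; rewrite !inE eqxx ?orbT.
Qed.

(* When control leaves the fragment, the answer is on top of the main stack. *)
Definition tm_of (F : fragment 4 cell) : tm symbol :=
  @TM symbol 3 void (fstate F + option bool)%type (inl (fstart F))
    (fun q => if q is inr b then b else None)
    (fun q r => match q with
      | inl q => let: (q', a) := fnext q r in
          (if q' is Some q1 then inl q1 else inr None, a)
      | inr _ => (inr (Some (is_top tapeM (token true) r)), keep r)
      end).

Lemma tm_of_exits F t (q : fstate F) ts ts' : exits t q ts ts' ->
  exists2 u, u <= t & iter u (@step symbol (tm_of F)) (inl q, ts) = (inr None, ts').
Proof.
elim: t q ts => // t IH q ts /=; case E: (fnext q (reads ts)) => [[q1|] a].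
  case/IH => u le_u <-; exists u.+1 => //; rewrite iterSr /step /=.
  by rewrite -/(reads ts) E.
by move=> <-; exists 1 => //; rewrite /= -/(reads ts) E.
Qed.

Lemma tm_of_decides F (w : seq symbol) (b : bool) t (Q : Prop) :
  computes F (stacks4 (map inl w) [::] [::] [::]) (on_main (word b)) t -> b <-> Q ->
  decides_within (tm_of F) t.+1 w Q.
Proof.
move=> Fw bQ.
pose ts0 : {ffun 'I_4 -> tape cell} := (init (tm_of F) w).2.
have ts0_hold : hold ts0 (stacks4 (map inl w) [::] [::] [::]).
  move=> i k; rewrite ffunE; case: i => -[|[|[|[|]]]] //= lt; rewrite ?onth0n ?nth_nil
      //.
  by rewrite onthE -map_comp.
have [ts1 /tm_of_exits[u le_u run] ts1_hold] := Fw _ ts0_hold.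
exists u.+1, b; split=> //=; rewrite run /= -/(reads ts1) (hold_reads ts1_hold).
by rewrite /is_top ffunE; case: b {Fw bQ ts1_hold}; rewrite /= token_top.
Qed.

Theorem theorem5p22 :
  exists (M : tm symbol) (p : {poly nat}),
    forall (hs : seq horn_default) (ws c : seq literal)
           (P : default -> default -> Prop),
      is_horn c ->
      strict_total_order (horn_D hs) P ->
      lists_by_priority P hs ->
      let phi := Not (clause c) in
      let w := encode hs ws c in
      decides_within M (p.[size w])%R w
        (entailsL (horn_D hs) (literals_W ws) P (Not phi)).
Proof.
have [F1 [k1 F1P]] := polytime_parse_rev; have [F2 [k2 F2P]] := polytime_decide.
(* Loading, parsing a code of length at most [14 * n + 1], deciding on the output of the parser, and
   one step that reads the answer. *)
pose b n := (2 + (40 * n + 1)) + ((14 * n + 3) ^ k1 + ((14 * n + 3) ^ k1 + 2) ^ k2) + 1.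
have [k bk] : poly_bounded b by rewrite /b; poly_bound.
exists (tm_of (fseq load (fseq F1 F2))), (('X + 2%:P) ^+ k)%R.
move=> hs ws c P _ orderP sortedP phi w.
have -> : ((('X + 2%:P) ^+ k).[size w])%R = (size w + 2) ^ k.
  by rewrite horner_exp hornerD hornerX hornerC natrXE.
have dec := decide_correct ws orderP sortedP c.
suff [t [r [le_t fin rQ]]] : decides_within (tm_of (fseq load (fseq F1 F2)))
    (b (size w)) w
    (entailsL (horn_D hs) (literals_W ws) P (Not phi)).
  by exists t, r; split=> //; apply: leq_trans le_t (bk _).
have [len1 run1] := F1P (rev w); rewrite revK in len1 run1.
pose z : seq (seq (bool * nat) * (bool * nat)) * (seq (bool * nat) * seq (bool * nat))
    :=
  (map rule_of_default hs, (ws, c)).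
have [_ run2] := F2P z.
(* The output of the parser is literally the code of the theory, so the second program can start on
   it at once. *)
have wordE : word (parse_word w) = word z by rewrite /word code_parse_encode.
have le_rev : len (rev w) <= 14 * size w + 1.
  by apply: leq_trans (len_symbols_le _) _; rewrite size_rev.
rewrite /b addn1; apply: (@tm_of_decides _ _ (decide z)); last exact: iff_sym dec.
apply: fseq_computes (@load_computes w) _.
have le1 : (len (rev w) + 2) ^ k1 <= (14 * size w + 3) ^ k1 by apply: leq_exp_l; lia.
have := run1 [::]; rewrite !cats0 => /(computes_leq le1)/fseq_computes; apply.
rewrite wordE; have := run2 [::]; rewrite !cats0 => /computes_leq; apply.
apply: leq_exp_l; rewrite leq_add2r {1}/len -wordE; exact: leq_trans len1 le1.
Qed.
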